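(* For a long flat virtual knot diagram $K$, choose a long virtual knot diagram $\widetilde K$ that overlies $K$ and set $$W_K(t)=\sum_{I(c)\neq0}o(c)\,w(c)\,t^{I(c)}\in\mathbb{Z}[t,t^{-1}],$$ the sum running over the arrows $c$ of the Gauss diagram $G(\widetilde K)$ with $I(c)\ne 0$. Then $W_K(t)$ is well defined (it does not depend on the choice of $\widetilde K$ overlying $K$) and it is an invariant of long flat virtual knots.
   Context: A long virtual knot diagram is an oriented 1-1 tangle diagram (one input end, one output end, oriented from left to right) with classical and virtual crossings. A long flat virtual knot diagram is a long virtual knot diagram in which the over/under information of classical crossings is forgotten; so it has virtual crossings and flat crossings. Long flat virtual knots are long flat virtual knot diagrams up to the generalized Reidemeister moves (classical moves $\Omega_1,\Omega_2,\Omega_3$, virtual moves $\Omega_1',\Omega_2',\Omega_3'$, and the mixed move $\Omega_3^s$ in which a strand with only virtual crossings is moved past a classical crossing) with all classical crossings replaced by flat crossings. A long virtual knot diagram $\widetilde K$ overlies $K$ if $K$ is obtained from $\widetilde K$ by forgetting the over/under information at every classical crossing. Gauss diagram $G(\widetilde K)$: the real line, oriented from left to right, with one arrow for each classical crossing $c$, drawn as a semicircle above the line and directed from the preimage of the overcrossing (tail) to the preimage of the undercrossing (head), with sign the writhe $w(c)\in\{\pm1\}$. For an arrow $c$: $o(c)=+1$ if $c$ is directed in the same direction as the line (tail to the left of head), and $o(c)=-1$ otherwise. The inside of $c$ is the segment of the line between the two endpoints of $c$; the rest of the line is the outside. Let $u_\pm(c)$ be the number of arrows of sign $\pm1$ crossing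 $c$ from inside to outside (tail inside, head outside) and $d_\pm(c)$ the number of arrows of sign $\pm1$ crossing $c$ from outside to inside (tail outside, head inside). Then $I(c)=u_+(c)-u_-(c)-d_+(c)+d_-(c)$. *)

(* Defs.v *)
From mathcomp Require Import all_boot all_order all_algebra.
From Stdlib Require Import Relations.

Set Implicit Arguments.
Unset Strict Implicit.
Unset Printing Implicit Defensive.

Import Order.TTheory GRing.Theory Num.Theory.
Local Open Scope ring_scope.

(* Diagrams.

   A tangle diagram in a strip, in general position with respect to the
   horizontal coordinate, is cut by vertical lines ("levels") into elementary
   slices, read from left to right.  At each level the strands are numbered
   0, 1, 2, ... from bottom to top.  A slice (i, g) carries the elementary
   piece g at height i and is trivial elsewhere:
     Birth    a turn-back open to the right, creating strands i and i+1;
     Death    a turn-back open to the left, joining strands i and i+1;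
     Cross c  a classical crossing of strands i and i+1, decorated by c : C;
     Virt     a virtual crossing of strands i and i+1.
   At a crossing one branch is ascending (it goes from height i on the left to
   height i+1 on the right) and the other one is descending.
   - C = bool: classical crossings with over/under information; c = true means
     that the ascending branch is the over branch.
   - C = unit: flat crossings. *)
Inductive piece (C : Type) : Type := Birth | Death | Cross of C | Virt.
Arguments Birth {C}.
Arguments Death {C}.
Arguments Virt {C}.

Definition slice (C : Type) : Type := (nat * piece C)%type.

Definition left_ends (C : Type) (g : piece C) : nat :=
  if g is Birth then 0%N else 2%N.

Definition right_ends (C : Type) (g : piece C) : nat :=
  if g is Death then 0%N else 2%N.

Definition turns (C : Type) (g : piece C) : bool :=
  match g with Birth | Death => true | _ => false end.

Fixpoint typed (C : Type) (n : nat) (D : seq (slice C)) (m : nat) : bool :=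
  if D is (i, g) :: D' then
    (i + left_ends g <= n)%N && typed (n - left_ends g + right_ends g) D' m
  else n == m.

(* The numbers of strands at the successive levels 0, ..., size D. *)
Fixpoint widths (C : Type) (n : nat) (D : seq (slice C)) : seq nat :=
  n :: (if D is (_, g) :: D' then widths (n - left_ends g + right_ends g) D'
        else [::]).

(* Walking along a strand.  A state (k, p, d) is the passage of the walker
   through strand p at level k, moving to the right if d = true and to the
   left if d = false; slice j lies between the levels j and j+1. *)
Definition state : Type := (nat * nat * bool)%type.

Definition next_slice (st : state) : nat :=
  let: (k, _, d) := st in if d then k else k.-1.

Definition across (i p : nat) : nat := if p == i then i.+1 else i.

(* Entering the slice (i, g) in direction d at height p, the walker leaves it
   at the returned height and in the returned direction. *)
Definition through (C : Type) (s : slice C) (p : nat) (d : bool) : nat * bool :=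
  let: (i, g) := s in
  let a := if d then left_ends g else right_ends g in
  let b := if d then right_ends g else left_ends g in
  if (p < i)%N then (p, d)
  else if (i + a <= p)%N then ((p - a + b)%N, d)
  else (across i p, if turns g then ~~ d else d).

Definition step (C : Type) (D : seq (slice C)) (st : state) : state :=
  let: (_, p, d) := st in
  let j := next_slice st in
  if onth D j is Some s then
    let: (p', d') := through s p d in (if d' then j.+1 else j, p', d')
  else st.

(* The walk from the input end; its length is the total number of points of
   the diagram on the levels. *)
Definition walk (C : Type) (D : seq (slice C)) : seq state :=
  traject (step D) (0%N, 0%N, true) (sumn (widths 1 D)).

(* A 1-1 tangle diagram without closed components: the walk from the input
   meets all the points of the diagram on the levels. *)
Definition long_knot (C : Type) (D : seq (slice C)) : bool :=
  typed 1 D 1 &&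
  all (fun k => all (fun p => (k, p) \in [seq st.1 | st <- walk D])
                    (iota 0 (nth 0%N (widths 1 D) k)))
      (iota 0 (size D).+1).

Record diagram (C : Type) : Type := Diagram {
  slices :> seq (slice C);
  slicesP : long_knot slices
}.

Definition long_virtual_diagram : Type := diagram bool.
Definition long_flat_diagram : Type := diagram unit.

Definition flatten_piece (g : piece bool) : piece unit :=
  match g with
  | Birth => Birth
  | Death => Death
  | Cross _ => Cross tt
  | Virt => Virt
  end.

Definition overlies (Kt : long_virtual_diagram) (K : long_flat_diagram) : Prop :=
  [seq (s.1, flatten_piece s.2) | s <- slices Kt] = slices K.

(* Moves on long flat virtual diagrams, generating an equivalence relation.

   The first five families generate planar isotopy of diagrams cut into slices:
   two slices with disjoint supports exchange their horizontal order, a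
   zigzag is straightened, and a crossing slides around a turn-back. *)
Definition crossing (v : bool) : piece unit := if v then Virt else Cross tt.

Inductive local_move : seq (slice unit) -> seq (slice unit) -> Prop :=
| Exchange i j g h : (i + right_ends g <= j)%N ->
    local_move [:: (i, g); (j, h)]
               [:: ((j - right_ends g + left_ends g)%N, h); (i, g)]
| Zigzag_up i : local_move [:: (i, Birth); (i.+1, Death)] [::]
| Zigzag_down i : local_move [:: (i.+1, Birth); (i, Death)] [::]
| Slide_birth i v :
    local_move [:: (i.+1, Birth); (i, crossing v)]
               [:: (i, Birth); (i.+1, crossing v)]
| Slide_death i v :
    local_move [:: (i, crossing v); (i.+1, Death)]
               [:: (i.+1, crossing v); (i, Death)]
(* The moves Omega_1, Omega_2, Omega_3 with flat crossings (v = false) and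
   Omega_1', Omega_2', Omega_3' with virtual crossings (v = true). *)
| Omega1_birth i v :
    local_move [:: (i, Birth); (i, crossing v)] [:: (i, Birth)]
| Omega1_death i v :
    local_move [:: (i, crossing v); (i, Death)] [:: (i, Death)]
| Omega2 i v : local_move [:: (i, crossing v); (i, crossing v)] [::]
| Omega3 i v :
    local_move [:: (i, crossing v); (i.+1, crossing v); (i, crossing v)]
               [:: (i.+1, crossing v); (i, crossing v); (i.+1, crossing v)]
(* The mixed move Omega_3^s; the strand with only virtual crossings is the
   top, the middle, or the bottom one on the left. *)
| Omega3s_top i :
    local_move [:: (i, Cross tt); (i.+1, Virt); (i, Virt)]
               [:: (i.+1, Virt); (i, Virt); (i.+1, Cross tt)]
| Omega3s_mid i :
    local_move [:: (i, Virt); (i.+1, Cross tt); (i, Virt)]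
               [:: (i.+1, Virt); (i, Cross tt); (i.+1, Virt)]
| Omega3s_bot i :
    local_move [:: (i, Virt); (i.+1, Virt); (i, Cross tt)]
               [:: (i.+1, Cross tt); (i, Virt); (i.+1, Virt)].

Definition flat_move (K K' : long_flat_diagram) : Prop :=
  exists pre A B post,
    [/\ slices K = pre ++ A ++ post,
        slices K' = pre ++ B ++ post
      & local_move A B].

(* Two diagrams represent the same long flat virtual knot. *)
Definition flat_equiv : relation long_flat_diagram :=
  clos_refl_sym_trans long_flat_diagram flat_move.

(* Gauss diagrams: arrows on a line whose distinguished points are numbered
   from left to right. *)
Record arrow : Type := Arrow { tail : nat; head : nat; sign : int }.

(* A passage (j, b, d) of the walk through the classical crossing of slice j:
   along the ascending branch iff b = true, to the right iff d = true. *)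
Definition passage (C : Type) (D : seq (slice C)) (st : state) :
    option (nat * bool * bool) :=
  let: (_, p, d) := st in
  let j := next_slice st in
  if onth D j is Some (i, Cross _) then
    if (i <= p <= i.+1)%N then Some (j, (p == i) == d, d) else None
  else None.

Definition passages (C : Type) (D : seq (slice C)) : seq (nat * bool * bool) :=
  pmap (passage D) (walk D).

Definition time (C : Type) (D : seq (slice C)) (j : nat) (b : bool) : nat :=
  find (fun q => q.1 == (j, b)) (passages D).

(* The tangent vector (rightward, upward) of branch b at the crossing j. *)
Definition velocity (C : Type) (D : seq (slice C)) (j : nat) (b : bool) :
    int * int :=
  let s : int := if (j, b, true) \in passages D then 1 else -1 in
  (s, if b then s else - s).

(* The crossing is positive iff (over branch, under branch) is a positively
   oriented frame of the plane. *)
Definition writhe (D : seq (slice bool)) (j : nat) (c : bool) : int :=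
  let o := velocity D j c in
  let u := velocity D j (~~ c) in
  Num.sg (o.1 * u.2 - o.2 * u.1).

Definition gauss_diagram (D : seq (slice bool)) : seq arrow :=
  pmap (fun j => if onth D j is Some (_, Cross c) then
                   Some (Arrow (time D j c) (time D j (~~ c)) (writhe D j c))
                 else None)
       (iota 0 (size D)).

Definition inside (c : arrow) (x : nat) : bool :=
  (minn (tail c) (head c) < x < maxn (tail c) (head c))%N.

Definition orient (c : arrow) : int := if (tail c < head c)%N then 1 else -1.

Definition ucount (G : seq arrow) (e : int) (c : arrow) : nat :=
  count (fun a => [&& sign a == e, inside c (tail a) & ~~ inside c (head a)]) G.

Definition dcount (G : seq arrow) (e : int) (c : arrow) : nat :=
  count (fun a => [&& sign a == e, ~~ inside c (tail a) & inside c (head a)]) G.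

Definition index_of (G : seq arrow) (c : arrow) : int :=
  (ucount G 1 c)%:Z - (ucount G (-1) c)%:Z
  - (dcount G 1 c)%:Z + (dcount G (-1) c)%:Z.

(* Z[t, t^-1] is seen as a subring of its field of fractions Q(t). *)
Definition tvar : {fraction {poly int}} := tofrac 'X.

Definition W (Kt : long_virtual_diagram) : {fraction {poly int}} :=
  let G := gauss_diagram Kt in
  \sum_(c <- G | index_of G c != 0)
     (orient c * sign c)%:~R * tvar ^ index_of G c.

(* Main.v *)
(* Give each passage x of the walk through a crossing the value e(x) = +-1 that
   is the sign of the frame (velocity at x, velocity at the other passage); the
   two passages of a crossing have opposite values.  Then o(c) w(c) is the value
   of the first passage of c, and I(c) is the sum of the values strictly between
   the two passages, because a crossing passed twice in between contributes 0.
   Neither mentions the over/under choice, so W is a function of the word of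
   passages of the flat diagram.

   A move replaces a box of slices.  The walks through the two diagrams agree
   outside the box, and make the same trips through it, so the words agree up to
   replacing the blocks of these trips.  Writing I(c) = e(x) (-1 - M), where x is
   the first passage of c and M is the sum over both passages y of c of e(y)
   times the sum of the values before y, makes the effect of a move on I(c) a sum
   over blocks which does not see in which order the walk visits the box.  For
   Omega_1 the removed crossing has I = 0; for Omega_2 the two removed crossings
   have equal I and opposite o w; for Omega_3 the blocks are reversed and the
   changes of M cancel. *)

Require Import Defs.
From mathcomp Require Import all_boot all_order all_algebra.
From mathcomp Require Import zify ring.

Set Implicit Arguments.
Unset Strict Implicit.
Unset Printing Implicit Defensive.

Import Order.TTheory GRing.Theory Num.Theory.
Local Open Scope ring_scope.

(** * Words of passages *)

(* A letter (j, b, d) is a passage as in [passages]: crossing, branch, direction. *)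
Notation letter := (nat * bool * bool)%type.

Section Words.
Implicit Types (P w : seq letter) (x : letter) (a : nat) (s : int).

(* The sign is +1 iff both passages of the crossing a go in the same horizontal
   direction; with the branch this determines the frame of velocities. *)
Definition same_way P a : int :=
  (-1) ^+ (((a, true, true) \in P) (+) ((a, false, true) \in P)).

(** For [k := same_way P] this is the sign e(x): when both branches run to the right, the ascending
    velocity followed by the descending one is a negative frame. [k] is a parameter because a block
    of a word does not determine the signs of its crossings. *)
Definition value (k : nat -> int) x : int := k x.1.1 * (-1) ^+ x.1.2.

Definition weight k w : int := \sum_(x <- w) value k x.

Definition mass k a w : int := \sum_(x <- w | x.1.1 == a) value k x.

(** The share of a block in M, where [s] is the sum of the values before the block. *)
Fixpoint moment k a s w : int :=
  if w is x :: w' then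
    (if x.1.1 == a then value k x * s else 0) + moment k a (s + value k x) w'
  else 0.

Definition initial k a w : int := head 0 [seq value k x | x <- w & x.1.1 == a].

(** The test encodes the restriction of the sum to arrows of nonzero index. *)
Definition monomial (e m : int) : {fraction {poly int}} :=
  if m != 0 then e%:~R * tvar ^ m else 0.

(* For the two passages of a this is o w t^I: see [contribution_split]. *)
Definition contribution k a w : {fraction {poly int}} :=
  monomial (initial k a w) (initial k a w * (- 1 - moment k a 0 w)).

Definition labels w : seq nat := [seq x.1.1 | x <- w].

Definition word_poly P : {fraction {poly int}} :=
  \sum_(a <- undup (labels P)) contribution (same_way P) a P.

(* Each crossing occurs exactly twice, once along each branch. *)
Definition gauss_word P : Prop :=
  uniq [seq x.1 | x <- P] /\
  forall a b, ((a, b) \in [seq x.1 | x <- P]) = (a \in labels P).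

Lemma monomial0 e : monomial e 0 = 0.
Proof. by rewrite /monomial eqxx. Qed.

Lemma monomialN e m : monomial (- e) m = - monomial e m.
Proof. by rewrite /monomial; case: ifP; rewrite ?oppr0 // rmorphN mulNr. Qed.

Lemma weight_cons k x w : weight k (x :: w) = value k x + weight k w.
Proof. by rewrite /weight big_cons. Qed.

Lemma mass_cons k a x w :
  mass k a (x :: w) = (if x.1.1 == a then value k x else 0) + mass k a w.
Proof. by rewrite /mass big_cons; case: ifP; rewrite ?add0r. Qed.

Lemma moment_cat k a s u w :
  moment k a s (u ++ w) = moment k a s u + moment k a (s + weight k u) w.
Proof.
elim: u s => [|x u IH] s /=; first by rewrite /weight big_nil addr0 add0r.
by rewrite IH weight_cons !addrA.
Qed.

(** The base multiplies only the mass, so blocks of equal mass react alike to a change of base. *)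
Lemma moment_base k a s w : moment k a s w = s * mass k a w + moment k a 0 w.
Proof.
elim: w s => [|x w IH] s /=; first by rewrite /mass big_nil mulr0 addr0.
by rewrite IH [in RHS]IH mass_cons; case: ifP => _; ring.
Qed.

Lemma initial_cat k a u w :
  initial k a (u ++ w) = if a \in labels u then initial k a u else initial k a w.
Proof.
rewrite /initial /labels; elim: u => //= x u IH; rewrite in_cons eq_sym.
by case: eqP => //=.
Qed.

Lemma moment_notin k a s w : a \notin labels w -> moment k a s w = 0.
Proof.
elim: w s => //= x w IH s; rewrite in_cons negb_or eq_sym => /andP[/negbTE -> /IH ->].
by rewrite addr0.
Qed.

Lemma mass_notin k a w : a \notin labels w -> mass k a w = 0.
Proof.
move=> aw; rewrite /mass big_seq_cond big1 // => x /andP[xw /eqP xa].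
by case/mapP: aw; exists x.
Qed.

Lemma eq_in_value k k' w : {in labels w, k =1 k'} ->
  {in w, value k =1 value k'}.
Proof. by move=> kk x xw; rewrite /value kk //; apply: (map_f (fun y => y.1.1)). Qed.

Lemma eq_in_moment k k' a s w : {in labels w, k =1 k'} ->
  moment k a s w = moment k' a s w.
Proof.
elim: w s => //= x w IH s kk.
rewrite (@eq_in_value k k' (x :: w) kk) ?mem_head // IH //.
by move=> b bw; apply: kk; rewrite in_cons bw orbT.
Qed.

Lemma eq_in_initial k k' a w : {in labels w, k =1 k'} -> initial k a w = initial k' a w.
Proof.
move=> kk; rewrite /initial; congr head; apply/eq_in_map => x.
by rewrite mem_filter => /andP[_]; apply: eq_in_value.
Qed.

Lemma eq_in_contribution k k' a w : {in labels w, k =1 k'} ->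
  contribution k a w = contribution k' a w.
Proof. by move=> kk; rewrite /contribution (eq_in_initial _ kk) (eq_in_moment _ _ kk). Qed.

Lemma same_way_sq P a : same_way P a * same_way P a = 1.
Proof. by rewrite /same_way; case: addb. Qed.

Lemma value_same_way_sq P x : value (same_way P) x * value (same_way P) x = 1.
Proof. by rewrite mulrACA same_way_sq; case: x.1.2. Qed.

Lemma gauss_word_direction P a b : gauss_word P -> a \in labels P ->
  ((a, b, false) \in P) = ~~ ((a, b, true) \in P).
Proof.
case=> uP cP aP; move: (cP a b); rewrite aP => /mapP[[[a' b'] d] xP [? ?]]; subst a' b'.
have un d1 d2 : (a, b, d1) \in P -> (a, b, d2) \in P -> d1 = d2.
  move=> h1 h2; move: uP; elim: P {cP aP xP} h1 h2 => // y P IH.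
  rewrite !in_cons /= => /orP[/eqP <-|h1] /orP[/eqP|h2] //; first by case.
  - by case/andP=> /mapP []; exists (a, b, d2).
  - by move=> yE; case/andP=> /mapP []; exists (a, b, d1); rewrite // -yE.
  - by case/andP=> _; apply: IH.
by case: d xP => h; rewrite h; [apply/negP|apply/esym/negP] => /(un _ _ h).
Qed.

(** Each branch is passed once, in one direction, so a sum over the passages of a crossing becomes a
    computation with two booleans. *)
Lemma gauss_word_pair P a : gauss_word P -> a \in labels P ->
  perm_eq [seq x <- P | x.1.1 == a]
    [:: (a, true, (a, true, true) \in P); (a, false, (a, false, true) \in P)].
Proof.
move=> gP aP; have [uP cP] := gP.
apply: uniq_perm; first by rewrite filter_uniq // (map_uniq uP).
  by rewrite /= inE !xpair_eqE andbF.
move=> [[a' b] d]; rewrite mem_filter !inE /= !xpair_eqE.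
case: eqP => //= ->; case: b d => -[] /=;
  rewrite ?gauss_word_direction //; by case: (_ \in P).
Qed.

Lemma mass_gauss_word P a : gauss_word P -> mass (same_way P) a P = 0.
Proof.
move=> gP; case: (boolP (a \in labels P)) => aP; last exact: mass_notin.
rewrite /mass -big_filter (perm_big _ (gauss_word_pair gP aP)) /=.
by rewrite !big_cons big_nil /value /= expr0 expr1 mulr1 mulrN1 addr0 addNr.
Qed.

(** Since e(y) = -e(x), the sum of the values before [x] cancels from M, leaving M = -1 - e(x) t'
    with t' the weight of [v]. Then e(x) (-1 - M) = t' because e(x)^2 = 1. *)
Lemma contribution_split P u x v y w : gauss_word P ->
  P = u ++ x :: v ++ y :: w -> y.1.1 = x.1.1 ->
  contribution (same_way P) x.1.1 P =
  monomial (value (same_way P) x) (weight (same_way P) v).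
Proof.
move=> gP; set k := same_way P => eP yx.
have aP : x.1.1 \in labels P by rewrite /labels eP map_cat mem_cat /= mem_head orbT.
(* Exactly two passages of the crossing occur, so none is left for [u], [v] and [w]. *)
have := perm_size (gauss_word_pair gP aP).
rewrite size_filter eP !count_cat /= eqxx !count_cat /= yx eqxx => ct.
have un t : count (fun z : letter => z.1.1 == x.1.1) t = 0%N -> x.1.1 \notin labels t.
  move=> c0; apply/mapP => -[z zt zx]; have: has (fun z : letter => z.1.1 == x.1.1) t.
    by apply/hasP; exists z; rewrite ?zx.
  by rewrite has_count c0.
have [/un nu /un nv /un nw] : [/\ count (fun z : letter => z.1.1 == x.1.1) u = 0,
  count (fun z : letter => z.1.1 == x.1.1) v = 0 &
  count (fun z : letter => z.1.1 == x.1.1) w = 0]%N.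
  by move: ct; case: (count _ u) (count _ v) (count _ w) => [|?] [|?] [|?] //=; lia.
have := mass_gauss_word x.1.1 gP; rewrite -/k eP.
rewrite /mass !(big_cat, big_cons) /= yx eqxx.
have m0 t : x.1.1 \notin labels t -> \sum_(z <- t | z.1.1 == x.1.1) value k z = 0.
  by move/mass_notin => /(_ k).
rewrite !m0 // add0r add0r addr0 addrC => /eqP; rewrite addr_eq0 => /eqP vy.
rewrite /contribution initial_cat (negbTE nu) {1 2}/initial /= eqxx /=.
rewrite !moment_cat /= eqxx !moment_cat /= yx eqxx !moment_notin // vy.
congr monomial; have := value_same_way_sq P x; rewrite -/k => sq.
rewrite !add0r !addr0.
set t := weight k u; set t' := weight k v; set z := value k x in sq *.
have -> : z * (-1 - (z * t + - z * (t + z + t'))) = z * (z * z - 1) + z * z * t' by ring.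
by rewrite sq subrr mulr0 add0r mul1r.
Qed.

(** Exchanging the two branches negates the branch factor of [value]; reversing exactly one of the
    two passages negates [same_way]. The condition on [turn] makes both happen together, so every
    value is kept. *)
Lemma word_poly_relabel P (f : nat -> nat) (flip : nat -> bool)
    (turn : nat -> bool -> bool) :
  let g x := (f x.1.1, x.1.2 (+) flip x.1.1, x.2 (+) turn x.1.1 x.1.2) in
  gauss_word P -> {in labels P &, injective f} ->
  (forall a, turn a true (+) turn a false = flip a) ->
  word_poly [seq g x | x <- P] = word_poly P.
Proof.
move=> g gP fI tE; set Q := map g P.
have lQ : labels Q = map f (labels P) by rewrite /labels -!map_comp.
have memQ a b d : a \in labels P -> ((f a, b, d) \in Q) =
    ((a, b (+) flip a, d (+) turn a (b (+) flip a)) \in P).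
  move=> aP; apply/mapP/idP => [[[[a' b'] d'] xP [] /fI aa -> ->]|xP].
    by rewrite aa ?(map_f (fun x => x.1.1) xP) //= -!addbA addbb addbF addbb addbF.
  by eexists; first exact: xP; rewrite /g /= -!addbA !addbb !addbF.
have vE x : x \in P -> value (same_way Q) (g x) = value (same_way P) x.
  move=> xP; have aP : x.1.1 \in labels P by apply: map_f.
  rewrite /value /same_way /= !memQ //.
  have dirF b : ((x.1.1, b, false) \in P) = ~~ ((x.1.1, b, true) \in P).
    exact: gauss_word_direction.
  move: (tE x.1.1); case: (flip x.1.1); case: x.1.2 => /=;
    case: (turn x.1.1 true); case: (turn x.1.1 false) => //= _;
    rewrite ?dirF ?dirF; case: ((_, true, true) \in P);
    by case: ((_, false, true) \in P).
have initialE a : a \in labels P ->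
    initial (same_way Q) (f a) Q = initial (same_way P) a P.
  move=> aP; rewrite /initial filter_map -map_comp; congr head.
  rewrite (_ : filter _ _ = [seq x <- P | x.1.1 == a]); last first.
    apply: eq_in_filter => x xP /=; apply/eqP/eqP => [/fI|-> //]; apply=> //.
    exact: map_f.
  by apply/eq_in_map => x; rewrite mem_filter => /andP[_ /vE].
have momentE a w s : {subset w <= P} -> a \in labels P ->
    moment (same_way Q) (f a) s (map g w) = moment (same_way P) a s w.
  elim: w s => //= x w IH s sP aP; rewrite vE ?sP ?mem_head // IH //; last first.
    by move=> y yw; rewrite sP // in_cons yw orbT.
  congr (_ + _); rewrite (_ : (f x.1.1 == f a) = (x.1.1 == a)) //.
  apply/eqP/eqP => [/fI|-> //]; apply=> //.
  by apply: map_f; rewrite sP ?mem_head.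
rewrite /word_poly lQ (perm_big (map f (undup (labels P)))) /=; last first.
  apply: uniq_perm; rewrite ?undup_uniq //.
    by rewrite map_inj_in_uniq ?undup_uniq // => a b; rewrite !mem_undup; apply: fI.
  move=> a; rewrite mem_undup; apply/mapP/mapP => -[b bP ->]; exists b => //;
  by move: bP; rewrite mem_undup.
rewrite big_map; apply: eq_big_seq => a; rewrite mem_undup => aP.
by rewrite /contribution initialE // momentE.
Qed.

(** Equal weights keep the base of every later block, and equal masses make that base cancel. What
    remains is a sum of changes computed at base 0, hence independent of the order of the blocks. *)
Lemma contribution_flatten k a (T : seq (seq letter * seq letter)) :
  {in T, forall p, weight k p.1 = weight k p.2} ->
  {in T, forall p, mass k a p.1 = mass k a p.2} ->
  {in T, forall p, (a \in labels p.1) = (a \in labels p.2)} ->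
  {in T, forall p, initial k a p.1 = initial k a p.2} ->
  \sum_(p <- T) (moment k a 0 p.1 - moment k a 0 p.2) = 0 ->
  contribution k a (flatten (unzip1 T)) = contribution k a (flatten (unzip2 T)).
Proof.
move=> tE mE lE fE sum0; rewrite /contribution.
have -> : initial k a (flatten (unzip1 T)) = initial k a (flatten (unzip2 T)).
  elim: T lE fE {tE mE sum0} => //= p T IH lE fE.
  rewrite !initial_cat lE ?fE ?mem_head // IH // => q qT;
  by [apply: lE; rewrite in_cons qT orbT | apply: fE; rewrite in_cons qT orbT].
(* The base is generalized for the induction over the blocks. *)
suff -> s : moment k a s (flatten (unzip1 T)) =
    moment k a s (flatten (unzip2 T)) +
    \sum_(p <- T) (moment k a 0 p.1 - moment k a 0 p.2) by rewrite sum0 addr0.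
elim: T s tE mE {lE fE sum0} => [|p T IH] s tE mE; first by rewrite big_nil addr0.
rewrite /= !moment_cat big_cons IH; last 2 first.
- by move=> q qT; apply: tE; rewrite in_cons qT orbT.
- by move=> q qT; apply: mE; rewrite in_cons qT orbT.
rewrite tE ?mem_head // (moment_base k a s p.1) (moment_base k a s p.2).
by rewrite mE ?mem_head //; ring.
Qed.

End Words.

(** * The moves Omega_1, Omega_2, Omega_3 on words *)

Section WordMoves.
Implicit Types (P w u : seq letter) (x : letter) (a n : nat) (us : seq (seq letter)).

(* A trip along a strand of a box, given by its passages from left to right. *)
Definition trip (st : seq (nat * bool)) (d : bool) : seq letter :=
  if d then [seq (y, true) | y <- st] else rev [seq (y, false) | y <- st].

Lemma flatten_mem_eq us x y :
  (forall u, u \in us -> (x \in u) = (y \in u)) ->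
  (x \in flatten us) = (y \in flatten us).
Proof.
by move=> xy; apply/flattenP/flattenP => -[u uu]; rewrite ?xy // -?xy // => h; exists u;
  rewrite // ?xy // -?xy.
Qed.

Lemma count_gauss_word P a (p : pred letter) : gauss_word P -> a \in labels P ->
  (forall x, p x -> x.1.1 = a) ->
  count p P = (p (a, true, (a, true, true) \in P) +
               p (a, false, (a, false, true) \in P))%N.
Proof.
move=> gP aP pa.
have -> : count p P = count p [seq x <- P | x.1.1 == a].
  rewrite count_filter; apply: eq_count => x /=; apply/idP/andP => [px|[]//].
  by rewrite px (pa x px).
by rewrite (permP (gauss_word_pair gP aP)) /= addn0.
Qed.

(** The joint mass of [A] vanishes on each block, so the base drops out and the joint moments of the
    blocks add up. [p] counts trips; on a Gauss word this count is known. *)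
Lemma moments_flatten k (A : seq nat) (p : pred letter) s us :
  {in us, forall u, \sum_(a <- A) mass k a u = 0} ->
  {in us, forall u, \sum_(a <- A) moment k a 0 u = - (count p u)%:Z} ->
  \sum_(a <- A) moment k a s (flatten us) = - (count p (flatten us))%:Z.
Proof.
elim: us s => [|u us IH] s mE cE /=; first by rewrite big1 ?oppr0.
rewrite count_cat PoszD opprD -(IH (s + weight k u)); last 2 first.
- by move=> v vus; apply: mE; rewrite in_cons vus orbT.
- by move=> v vus; apply: cE; rewrite in_cons vus orbT.
rewrite -cE ?mem_head // -big_split /=.
under eq_bigr do rewrite moment_cat moment_base -addrA.
by rewrite big_split /= -mulr_sumr mE ?mem_head // mulr0 add0r.
Qed.

(** A deleted block has weight 0, so it shifts no later base and leaves the contributions of the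
    kept crossings unchanged. *)
Lemma word_poly_delete (out : pred nat) us :
  let P := flatten us in
  {in us, forall u, all out (labels u) \/
     ~~ has out (labels u) /\ weight (same_way P) u = 0} ->
  word_poly P = word_poly [seq x <- P | out x.1.1] +
    \sum_(a <- undup (labels P) | ~~ out a) contribution (same_way P) a P.
Proof.
move=> P usP; set Q := filter _ P.
have lQ : labels Q = filter out (labels P) by rewrite /labels filter_map.
rewrite /word_poly (bigID out) /=; congr (_ + _).
rewrite lQ -filter_undup big_filter [LHS]big_seq_cond [RHS]big_seq_cond.
apply: eq_bigr => a /andP[_ oa].
have swE : {in labels Q, same_way P =1 same_way Q}.
  by move=> b; rewrite lQ mem_filter => /andP[ob _]; rewrite /same_way !mem_filter /= ob.
rewrite -(eq_in_contribution _ swE) {swE}.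
pose T := [seq (u, [seq x <- u | out x.1.1]) | u <- us].
have -> : Q = flatten (unzip2 T).
  by rewrite /Q /P /T filter_flatten /unzip2 -map_comp.
rewrite {2}/P (_ : us = unzip1 T); last first.
  by rewrite /T /unzip1 -map_comp map_id.
have TP : {in T, forall p, p.1 = p.2 \/
    [/\ a \notin labels p.1, p.2 = [::] & weight (same_way P) p.1 = 0]}.
  move=> p /mapP[u /usP uE ->]; case: uE => [al|[no t0]] /=; [left|right].
    apply/esym/all_filterP/allP => x xu; apply: (allP al).
    exact: (map_f (fun y => y.1.1)).
  split=> //; first by apply: contra no => au; apply/hasP; exists a.
  apply/eqP; rewrite -size_eq0 size_filter -leqn0 leqNgt -has_count.
  apply: contra no => /hasP[x xu ox]; apply/hasP; exists x.1.1 => //.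
  exact: (map_f (fun y => y.1.1)).
apply: contribution_flatten => [p|p|p|p|];
  try by case/TP=> [->//|[na -> t0]]; rewrite /= ?t0 ?(negbTE na) ?mass_notin ?/weight ?big_nil.
- case/TP=> [->//|[na -> _]]; rewrite /initial.
  rewrite (_ : filter _ p.1 = [::]) //; apply/eqP.
  rewrite -size_eq0 size_filter -leqn0 leqNgt -has_count.
  apply: contra na => /hasP[x xu /eqP <-].
  exact: (map_f (fun y => y.1.1)).
- rewrite big_seq big1 // => p /TP[->|[na -> _]]; first by rewrite subrr.
  by rewrite moment_notin // subrr.
Qed.

(** The trip around the kink has values e, -e and hence moment -e * e = -1. There is one such trip,
    since it contains the only passage along the ascending branch. So M = -1 and the index is 0. *)
Lemma word_poly_omega1 us n :
  let P := flatten us in gauss_word P ->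
  {in us, forall u, n \notin labels u \/
     exists b d, u = [:: (n, b, d); (n, ~~ b, ~~ d)]} ->
  word_poly P = word_poly [seq x <- P | x.1.1 != n].
Proof.
move=> P gP usP; set k := same_way P.
have usT : {in us, forall u, n \notin labels u \/
   (labels u = [:: n; n] /\ count (fun x => x.1 == (n, true)) u = 1)%N /\
   exists v, u = [:: v.1; v.2] /\ value k v.2 = - value k v.1}.
  move=> u /usP[|[b [d ->]]]; [by left|right; split].
    by case: b; split; rewrite //= !xpair_eqE !eqxx.
  exists ((n, b, d), (n, ~~ b, ~~ d)); split=> //.
  by rewrite /value /=; case: b; rewrite !(expr0, expr1) ?mulrN1 ?mulr1 ?opprK.
rewrite (@word_poly_delete (fun a => a != n)); last first.
  move=> u /usT[nu|[[lu _] [v [uE vE]]]]; [left|right].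
    by apply/allP => a au; apply: contraNneq nu => <-.
  by rewrite lu /= eqxx uE /weight !big_cons big_nil vE addr0 subrr.
rewrite big_seq_cond big1 ?addr0 // => a; rewrite mem_undup => /andP[aP].
rewrite negbK => /eqP an; rewrite {a}an in aP *.
suff -> : contribution k n P = monomial (initial k n P) 0 by rewrite monomial0.
rewrite /contribution; congr monomial.
suff -> : moment k n 0 P = -1 by rewrite opprK addNr mulr0.
have := @moments_flatten k [:: n] (fun x => x.1 == (n, true)) 0 us.
rewrite big_seq1 => ->; first by rewrite (count_gauss_word gP aP) /= ?xpair_eqE ?eqxx // => x /eqP ->.
all: move=> u /usT[nu|[[lu cu] [v [uE vE]]]]; rewrite big_seq1.
- exact: mass_notin.
- move: lu; rewrite uE => -[l1 l2]; rewrite !mass_cons l1 l2 eqxx vE.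
  by rewrite /mass big_nil addr0 subrr.
- rewrite moment_notin // (_ : count _ _ = 0%N) //; apply/eqP.
  rewrite -leqn0 leqNgt -has_count; apply: contra nu => /hasP[x xu /eqP xn].
  by apply/mapP; exists x => //; rewrite xn.
- rewrite cu; move: lu; rewrite uE => -[l1 l2] /=; rewrite l1 l2 eqxx vE.
  by rewrite mulr0 !add0r addr0 mulNr value_same_way_sq.
Qed.

(** The strands that start at the bottom left and at the top left of the bigon. *)
Definition omega2_strands n : seq (seq (nat * bool)) :=
  [:: [:: (n, true); (n.+1, false)]; [:: (n, false); (n.+1, true)]].

(** Each of the two trips through the bigon has values e, -e on the two crossings, so the two first
    values are opposite and the joint moment of a trip is -1. Thus the two moments add up to -2,
    which makes the indices equal, and the contributions cancel. *)
Lemma word_poly_omega2 us n :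
  let P := flatten us in gauss_word P ->
  n \in labels P -> n.+1 \in labels P ->
  {in us, forall u, (n \notin labels u /\ n.+1 \notin labels u) \/
     exists st d, st \in omega2_strands n /\ u = trip st d} ->
  word_poly P = word_poly [seq x <- P | x.1.1 \notin [:: n; n.+1]].
Proof.
move=> P gP nP n1P usP; set k := same_way P.
have nn1 : (n == n.+1) = false by lia.
have n1n : (n.+1 == n) = false by lia.
(* The ascending branch of either crossing shares its strand, hence its direction, with the
   descending branch of the other. *)
have kE : k n.+1 = k n.
{ rewrite /k /same_way [in RHS]addbC; congr (_ ^+ (_ (+) _));
  apply: flatten_mem_eq => u /usP[[nu n1u]|[st [d [stE ->]]]].
  1,3: by apply/idP/idP => /(map_f (fun y => y.1.1)); rewrite ?(negbTE nu) ?(negbTE n1u).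
  all: move: stE; rewrite !inE => /orP[]/eqP->; rewrite /trip; case: d;
    by rewrite /= ?/rev /= !inE !xpair_eqE ?eqxx ?nn1 ?n1n. }
have usT : {in us, forall u, (n \notin labels u /\ n.+1 \notin labels u) \/
   [/\ ~~ has (fun a => a \notin [:: n; n.+1]) (labels u),
    weight k u = 0, (n \in labels u) && (n.+1 \in labels u),
    mass k n u + mass k n.+1 u = 0 /\ initial k n.+1 u = - initial k n u
   & moment k n 0 u + moment k n.+1 0 u = - 1 /\
      count (fun x => x.1.1 == n) u = 1%N]}.
  move=> u /usP[|[st [d [stE ->]]]]; [by left|right].
  have kk : k n = 1 \/ k n = -1.
    by rewrite /k /same_way; case: addb; [right|left].
  move: stE; rewrite !inE => /orP[]/eqP->; rewrite /trip; case: d; split;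
    rewrite /= ?/rev /= ?/initial ?mass_cons /= ?inE ?eqxx ?nn1 ?n1n ?orbT //=
    /mass /weight ?big_cons ?big_nil /value /= ?kE ?expr0 ?expr1 //=;
  try (split=> //); by case: kk => ->.
rewrite (@word_poly_delete (fun a => a \notin [:: n; n.+1])); last first.
  move=> u /usT[[nu n1u]|[no t0 _ _ _]]; [left|by right].
  by apply/allP => a au; rewrite !inE; apply/norP; split; [apply: contraNneq nu|
    apply: contraNneq n1u] => <-.
rewrite -[RHS]addr0; congr (_ + _).
rewrite -big_filter (perm_big [:: n; n.+1]) /=; last first.
  apply: uniq_perm; rewrite ?filter_uniq ?undup_uniq //=; first by rewrite !inE nn1.
  move=> a; rewrite mem_filter mem_undup !inE negbK andbC.
  by case: eqP => [->|_]; rewrite ?nP //=; case: eqP => [->|]; rewrite ?n1P ?andbF.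
rewrite big_cons big_seq1 -/P -/k /contribution.
have -> : initial k n.+1 P = - initial k n P.
  rewrite /P; move: usT; elim: (us) => [|u s IH] sT; first by rewrite oppr0.
  rewrite /= !initial_cat; case: (sT u (mem_head _ _)) => [[/negbTE -> /negbTE ->]|].
    by apply: IH => v vs; apply: sT; rewrite in_cons vs orbT.
  by case=> _ _ /andP[-> ->] [_ ->] _.
have mE : moment k n 0 P + moment k n.+1 0 P = - 2%:Z.
  have := @moments_flatten k [:: n; n.+1] (fun x => x.1.1 == n) 0 us.
  rewrite -/P (count_gauss_word gP nP) /= ?eqxx; last by move=> x /eqP.
  rewrite big_cons big_seq1 => -> // u /usT; rewrite big_cons big_seq1.
    by case=> [[nu n1u]|[_ _ _ [] //]]; rewrite !mass_notin.
  case=> [[nu n1u]|[_ _ _ _ [-> ->]] //]; rewrite !moment_notin //.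
  rewrite (_ : count _ _ = 0%N) //; apply/eqP.
  rewrite -leqn0 leqNgt -has_count; apply: contra nu => /hasP[x xu /eqP xn].
  by apply/mapP; exists x => //; rewrite xn.
have -> : moment k n.+1 0 P = - 2%:Z - moment k n 0 P by rewrite -mE addrC addKr.
rewrite monomialN (_ : - initial k n P * _ = initial k n P * (-1 - moment k n 0 P)).
  by rewrite subrr.
by ring.
Qed.

(** Listed by their left ends, from bottom to top. *)
Definition omega3_strands n : seq (seq (nat * bool)) :=
  [:: [:: (n, true); (n.+1, true)]; [:: (n, false); (n.+2, true)];
      [:: (n.+1, false); (n.+2, false)]].

Lemma weight_rev k u : weight k (rev u) = weight k u.
Proof. by rewrite /weight; apply: perm_big; rewrite perm_rev. Qed.

Lemma mass_rev k a u : mass k a (rev u) = mass k a u.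
Proof. by rewrite /mass; apply: perm_big; rewrite perm_rev. Qed.

Lemma perm_flatten_rev us : perm_eq (flatten (map rev us)) (flatten us).
Proof. by elim: us => //= u us IH; apply: perm_cat; rewrite ?perm_rev. Qed.

Lemma sum_flatten (h : letter -> int) us :
  \sum_(x <- flatten us) h x = \sum_(u <- us) \sum_(x <- u) h x.
Proof. by elim: us => [|u us IH]; rewrite ?big_nil // big_cons big_cat IH. Qed.

(** Reversing a trip with values v, v' changes only its two moments, by opposite amounts v v'. For
    each of the three crossings the changes coming from its two strands cancel. *)
Lemma word_poly_omega3 us n :
  let P := flatten us in gauss_word P ->
  n \in labels P -> n.+1 \in labels P -> n.+2 \in labels P ->
  {in us, forall u, u = [::] \/
     (exists x, u = [:: x] /\ x.1.1 \notin [:: n; n.+1; n.+2]) \/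
     exists st d, st \in omega3_strands n /\ u = trip st d} ->
  word_poly P = word_poly (flatten (map rev us)).
Proof.
move=> P gP nP n1P n2P usP; set Q := flatten _.
have pQP : perm_eq Q P by apply: perm_flatten_rev.
have swE a : same_way Q a = same_way P a by rewrite /same_way !(perm_mem pQP).
have e01 : (n == n.+1) = false by lia.
have e10 : (n.+1 == n) = false by lia.
have e02 : (n == n.+2) = false by lia.
have e20 : (n.+2 == n) = false by lia.
have e12 : (n.+1 == n.+2) = false by lia.
have e21 : (n.+2 == n.+1) = false by lia.
pose simp := (e01, e10, e02, e20, e12, e21, eqxx).
rewrite /word_poly [RHS](perm_big (undup (labels P))) /=; last first.
  by apply: perm_undup => a; rewrite /labels (perm_mem (perm_map _ pQP)).
apply: eq_bigr => a _; rewrite -(@eq_in_contribution (same_way P)); last first.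
  by move=> b _; rewrite swE.
set k := same_way P.
pose T := [seq (u, rev u) | u <- us].
have -> : Q = flatten (unzip2 T) by rewrite /unzip2 -map_comp.
rewrite /P (_ : us = unzip1 T); last by rewrite /unzip1 -map_comp map_id.
apply: contribution_flatten; try move=> _ /mapP[u us_u ->] /=.
- by rewrite weight_rev.
- by rewrite mass_rev.
- by rewrite /labels map_rev mem_rev.
- case: (usP u us_u) => [-> //|[[x [-> _]] //|[st [d [stE ->]]]]].
  rewrite /initial filter_rev map_rev; congr head.
  by move: stE; rewrite !inE => /or3P[]/eqP->; rewrite /trip; case: d;
    rewrite /= ?/rev /=; do ![case: eqP => ?] => //; lia.
rewrite big_map /=.
have [aP|aP] := boolP (a \in [:: n; n.+1; n.+2]); last first.
  rewrite big_seq big1 // => u /usP[-> //|[[x [-> _]] //|[st [d [stE ->]]]]].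
    by rewrite subrr.
  rewrite !moment_notin ?subrr // /labels ?map_rev ?mem_rev; apply: contra aP;
  by move: stE; rewrite !inE => /or3P[]/eqP->; rewrite /trip; case: d;
    rewrite /= ?/rev /= !inE => /orP[]->; rewrite ?orbT.
(* A leftward trip meets its two crossings in the opposite order, which negates the change. *)
pose sg (d : bool) : int := if d then 1 else -1.
(* The change of the moment of b along a trip is the sum of h b over its letters,
     which turns the sum over the trips into a sum over the two passages of b. *)
pose h b x : int := if x.1.1 != b then 0 else sg x.2 * (
  if b == n then (if x.1.2 then - (k n * k n.+1) else k n * k n.+2) else
  if b == n.+1 then (if x.1.2 then k n * k n.+1 else - (k n.+1 * k n.+2)) else
  (if x.1.2 then - (k n * k n.+2) else k n.+1 * k n.+2)).
transitivity (\sum_(x <- P) h a x).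
  rewrite sum_flatten; apply: eq_big_seq => u /usP[->|[[x [-> xn]]|[st [d [stE ->]]]]].
  - by rewrite subrr big_nil.
  - rewrite subrr big_seq1 /h ifT //; apply: contra xn => /eqP ->; exact: aP.
  move: aP stE; rewrite !inE => /or3P[]/eqP-> /or3P[]/eqP->; rewrite /trip; case: d;
    rewrite /= ?/rev /= !big_cons big_nil /h /= !simp /= /value /sg /= ?expr0 ?expr1;
  by ring.
(* Passages on one strand share their direction, so the signs depend on three directions only, and
   eight cases remain. *)
have m1 : ((n.+1, true, true) \in P) = ((n, true, true) \in P).
  apply: flatten_mem_eq => u /usP[->//|[[x [-> xn]]|[st [d [stE ->]]]]].
    rewrite !inE; case: eqP xn => [<-|_]; first by rewrite !inE eqxx orbT.
    by case: eqP => // <-; rewrite !inE eqxx.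
  by move: stE; rewrite !inE => /or3P[]/eqP->; rewrite /trip; case: d;
    rewrite /= ?/rev /= !inE !xpair_eqE /= ?simp ?andbF.
have m2 : ((n.+2, true, true) \in P) = ((n, false, true) \in P).
  apply: flatten_mem_eq => u /usP[->//|[[x [-> xn]]|[st [d [stE ->]]]]].
    rewrite !inE; case: eqP xn => [<-|_]; first by rewrite !inE eqxx !orbT.
    by case: eqP => // <-; rewrite !inE eqxx.
  by move: stE; rewrite !inE => /or3P[]/eqP->; rewrite /trip; case: d;
    rewrite /= ?/rev /= !inE !xpair_eqE /= ?simp ?andbF.
have m3 : ((n.+2, false, true) \in P) = ((n.+1, false, true) \in P).
  apply: flatten_mem_eq => u /usP[->//|[[x [-> xn]]|[st [d [stE ->]]]]].
    rewrite !inE; case: eqP xn => [<-|_]; first by rewrite !inE eqxx !orbT.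
    by case: eqP => // <-; rewrite !inE eqxx orbT.
  by move: stE; rewrite !inE => /or3P[]/eqP->; rewrite /trip; case: d;
    rewrite /= ?/rev /= !inE !xpair_eqE /= ?simp ?andbF.
have aP' : a \in labels P by move: aP; rewrite !inE => /or3P[]/eqP->.
have -> : \sum_(x <- P) h a x = \sum_(x <- P | x.1.1 == a) h a x.
  rewrite [RHS]big_mkcond; apply: eq_bigr => x _; rewrite /h.
  by case: eqP.
rewrite -big_filter (perm_big _ (gauss_word_pair gP aP')) /= !big_cons big_nil.
rewrite /h /= eqxx /= addr0 /k /same_way m1 m2 m3.
move: aP; rewrite !inE => /or3P[]/eqP->; rewrite ?simp ?m1 ?m2 ?m3;
by case: ((n, true, true) \in P); case: ((n, false, true) \in P);
  case: ((n.+1, false, true) \in P).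
Qed.

End WordMoves.

(** * Walks on a zipper, and boxes of slices *)

Section Zipper.

Notation fslice := (slice unit).

(* The slices on the left (nearest first), the slices on the right, the height
   and the direction of the walker. *)
Definition zipper := (seq fslice * seq fslice * nat * bool)%type.

Definition emit (j : nat) (s : fslice) (p : nat) (d : bool) : seq letter :=
  if s is (i, Cross _) then
    if (i <= p <= i.+1)%N then [:: (j, (p == i) == d, d)] else [::]
  else [::].

(** A slice is numbered by the length of the list on its left, and a step inspects only the nearest
    slice. A box can therefore be walked through while its surroundings remain variables. *)
Definition zstep (z : zipper) : option (seq letter * zipper) :=
  let: (l, r, p, d) := z in
  if d then
    if r is s :: r' then
      let: (p', d') := through s p true in
      Some (emit (size l) s p true,
            if d' then (s :: l, r', p', true) else (l, r, p', false))
    else None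
  else
    if l is s :: l' then
      let: (p', d') := through s p false in
      Some (emit (size l') s p false,
            if d' then (l, r, p', true) else (l', s :: r, p', false))
    else None.

Inductive zrun : nat -> zipper -> seq letter -> zipper -> Prop :=
| zrun0 z : zrun 0 z [::] z
| zrunS n z u z1 w z2 :
    zstep z = Some (u, z1) -> zrun n z1 w z2 -> zrun n.+1 z (u ++ w) z2.

Definition exited (z : zipper) : bool :=
  if z is (_, [::], _, true) then true else false.

Lemma exited_zstep z : exited z -> zstep z = None.
Proof. by case: z => [[[l [|s r]] p] []]. Qed.

Lemma zrun_step n z u z1 w z2 : zstep z = Some (u, z1) ->
  zrun n z w z2 -> exited z2 ->
  exists n' w', [/\ n = n'.+1, w = u ++ w' & zrun n' z1 w' z2].
Proof.
move=> st h; case: h st => {n z w z2} [z|n z v z3 w z2 -> h] st ex.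
  by rewrite exited_zstep in st.
by case: st => <- <-; exists n, w.
Qed.

Lemma zrun_stuck n z w z2 : zstep z = None -> zrun n z w z2 -> w = [::] /\ z2 = z.
Proof. by move=> st h; case: h st => {n z w z2} [z|n z v z3 w z2 ->]. Qed.

(** Steps are deterministic and none is possible after the exit, so a complete run extends every run
    from the same start. *)
Lemma zrun_prefix m n z u z1 w z2 :
  zrun m z u z1 -> zrun n z w z2 -> exited z2 ->
  exists n' w', [/\ n = (m + n')%N, w = u ++ w' & zrun n' z1 w' z2].
Proof.
move=> h; elim: h n w => {m z u z1} [z|m z u z1 v z3 st _ IH] n w h ex.
  by exists n, w.
have [n1 [w1 [-> -> /IH]]] := zrun_step st h ex.
by case=> // n2 [w2 [-> -> h2]]; exists n2, w2; rewrite catA.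
Qed.

Definition entry (A l r : seq fslice) (p : nat) (d : bool) : zipper :=
  if d then (l, A ++ r, p, true) else (rev A ++ l, r, p, false).

Inductive box_exit (A l r : seq fslice) : nat -> bool -> zipper -> Prop :=
| exit_left p : box_exit A l r p false (l, A ++ r, p, false)
| exit_right p : box_exit A l r p true (rev A ++ l, r, p, true).

(** Matched trips leave on the same side at the same height. An empty box is crossed in no step, so
    progress is required of the two trips together. *)
Definition boxes_match (n : nat) (R : seq letter -> seq letter -> Prop)
    (A B : seq fslice) : Prop :=
  forall (l r : seq fslice) (p : nat) (d : bool), size l = n ->
  exists m u z p1 e m' v z' p2,
    [/\ zrun m (entry A l r p d) u z /\ box_exit A l r p1 e z,
        zrun m' (entry B l r p d) v z' /\ box_exit B l r p2 e z',
        p1 = p2, R u v & (0 < m + m')%N].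

Section Simulation.
Variables (n : nat) (R : seq letter -> seq letter -> Prop) (A B : seq fslice).
Hypothesis match_AB : boxes_match n R A B.
Hypothesis R_nil : R [::] [::].
Hypothesis R_before : forall j b d, (j < n)%N -> R [:: (j, b, d)] [:: (j, b, d)].
Hypothesis R_after : forall j b d,
  R [:: (j + size A + n, b, d)%N] [:: (j + size B + n, b, d)%N].

(** Both walkers stand at corresponding places, to the left or to the right of the box, possibly on
    its border. *)
Inductive outside : zipper -> zipper -> Prop :=
| outside_left l r0 r p d : (size l + size r0 = n)%N ->
    outside (l, r0 ++ A ++ r, p, d) (l, r0 ++ B ++ r, p, d)
| outside_right l l0 r p d : size l = n ->
    outside (l0 ++ rev A ++ l, r, p, d) (l0 ++ rev B ++ l, r, p, d).

Lemma R_emit_before j s p d : (j < n)%N -> R (emit j s p d) (emit j s p d).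
Proof.
by move=> jn; rewrite /emit; case: s => i [||?|]; rewrite ?R_nil //; case: ifP => // _;
  apply: R_before.
Qed.

Lemma R_emit_after j s p d :
  R (emit (j + size A + n) s p d) (emit (j + size B + n) s p d).
Proof.
by rewrite /emit; case: s => i [||?|]; rewrite ?R_nil //; case: ifP => // _; apply: R_after.
Qed.

(* Outside the box the two walks run in lockstep, and at the box they make
   matching trips through it. *)
Lemma outside_step z z' : outside z z' -> (zstep z = None /\ zstep z' = None) \/
  exists m u z1 m' v z1', [/\ zrun m z u z1, zrun m' z' v z1', outside z1 z1',
    R u v & (0 < m + m')%N].
Proof.
have boxed l r p d : size l = n -> exists m u z1 m' v z1',
    [/\ zrun m (entry A l r p d) u z1, zrun m' (entry B l r p d) v z1',
      outside z1 z1', R u v & (0 < m + m')%N].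
  move=> ln; have [m [u [z1 [p1 [e [m' [v [z1' [p2 H]]]]]]]]] := match_AB r p d ln.
  case: H => -[run ex] [run' ex'] p12 Ruv mm; exists m, u, z1, m', v, z1'; split=> //.
  case: ex run ex' p12 {run'} => {}p1 _ ex'.
    by inversion ex' => ->; apply: (@outside_left _ [::]); rewrite addn0.
  by inversion ex' => ->; apply: (@outside_right _ [::]).
have single y y' u v y1 y1' : zstep y = Some (u, y1) -> zstep y' = Some (v, y1') ->
    outside y1 y1' -> R u v -> exists m u z1 m' v z1',
    [/\ zrun m y u z1, zrun m' y' v z1', outside z1 z1', R u v & (0 < m + m')%N].
  move=> st st' o Ruv; exists 1%N, u, y1, 1%N, v, y1'; split=> //.
    by rewrite -[u]cats0; apply: zrunS st _; apply: zrun0.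
  by rewrite -[v]cats0; apply: zrunS st' _; apply: zrun0.
case=> [l r0 r p d ln|l l0 r p d ln]; case: d.
- case: r0 ln => [|s r0] ln; right.
    by apply: (boxed l r p true); rewrite -ln addn0.
  case E: (through s p true) => [p' d'].
  apply: single; first by rewrite /= E.
  - by rewrite /= E.
  - case: d' {E}; [apply: (@outside_left (s :: l) r0) | apply: (@outside_left l (s :: r0))];
      by rewrite -ln /= ?addSnnS.
  - by apply: R_emit_before; rewrite -ln /=; lia.
- case: l ln => [|s l] ln; [by left|right].
  case E: (through s p false) => [p' d'].
  apply: single; first by rewrite /= E.
  - by rewrite /= E.
  - case: d' {E}; [apply: (@outside_left (s :: l) r0) | apply: (@outside_left l (s :: r0))];
      by rewrite -ln /= ?addSnnS.
  - by apply: R_emit_before; rewrite -ln /=; lia.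
- case: r => [|s r]; [by left|right].
  case E: (through s p true) => [p' d'].
  apply: single; first by rewrite /= E.
  - by rewrite /= E.
  - case: d' {E}; [exact: (@outside_right l (s :: l0)) | exact: (@outside_right l l0)].
  - by rewrite !size_cat !size_rev ln !addnA; apply: R_emit_after.
- case: l0 => [|s l0]; right; first exact: (boxed l r p false).
  case E: (through s p false) => [p' d'].
  apply: single; first by rewrite /= E.
  - by rewrite /= E.
  - case: d' {E}; [exact: (@outside_right l (s :: l0)) | exact: (@outside_right l l0)].
  - by rewrite !size_cat !size_rev ln !addnA; apply: R_emit_after.
Qed.

(** Strong induction on the total number of steps, since one of the two walks may stand still during
    a matched trip. *)
Lemma outside_run m m' z z' w w' z2 z2' : outside z z' ->
  zrun m z w z2 -> zrun m' z' w' z2' -> exited z2 -> exited z2' ->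
  exists T : seq (seq letter * seq letter),
    [/\ w = flatten (unzip1 T), w' = flatten (unzip2 T)
      & {in T, forall p, R p.1 p.2}].
Proof.
have [N] := ubnP (m + m'); elim: N m m' z z' w w' => // N IH m m' z z' w w' le o h h' ex ex'.
case: (outside_step o) => [[st st']|].
  by exists [::]; have [-> _] := zrun_stuck st h; have [-> _] := zrun_stuck st' h'.
case=> k [u [z1 [k' [v [z1' [hk hk' o1 Ruv kk]]]]]].
have [m1 [w1 [mE -> h1]]] := zrun_prefix hk h ex.
have [m1' [w1' [mE' -> h1']]] := zrun_prefix hk' h' ex'.
have [|T [-> -> RT]] := IH m1 m1' z1 z1' w1 w1' _ o1 h1 h1' ex ex'; first by lia.
exists ((u, v) :: T); split=> // p; rewrite in_cons => /orP[/eqP -> //|].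
exact: RT.
Qed.

End Simulation.

End Zipper.

(** * Tactics that execute a walk through an explicit box *)

Ltac decide_ifs :=
  cbn beta iota;
  repeat (match goal with
  | |- context [if (?a <= ?b)%N then _ else _] =>
     first [ rewrite (_ : (a <= b)%N = true); [|lia]
           | rewrite (_ : (a <= b)%N = false); [|lia]]
  | |- context [if (?a <= ?b <= ?c)%N then _ else _] =>
     first [ rewrite (_ : (a <= b <= c)%N = true); [|lia]
           | rewrite (_ : (a <= b <= c)%N = false); [|lia]]
  | |- context [@eq_op _ ?a ?b] =>
     first [ rewrite (_ : (a == b) = true); [|lia]
           | rewrite (_ : (a == b) = false); [|lia]]
  end; cbn beta iota).

Ltac zstep_go :=
  cbn [zstep through emit left_ends right_ends turns negb]; decide_ifs; unfold across; cbn [negb];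
  decide_ifs; reflexivity.

Ltac zrun_go :=
  repeat (eapply zrunS; [zstep_go|]);
  apply: zrun0.

Ltac exit_go := first [eapply exit_right | eapply exit_left].
(** The nine witnesses of [boxes_match] stay open and are filled in by executing both walks. *)
Ltac box_go :=
  do 9 eexists; split;
  [ split; [zrun_go | exit_go]
  | split; [zrun_go | exit_go]
  | try lia | |].


(* Sends the crossings of pre ++ B ++ post, with size pre = n, size A = a and
   size B = b, to those of pre ++ A ++ post.  When a crossing slides around a
   turn-back, its two branches are exchanged and the branch c with
   c (+) q = true, the one with the turn-back, changes direction. *)
Definition relabel (n a b : nat) (reverse : bool) (slide : option bool) (x : letter) :
    letter :=
  let: (j, c, d) := x in
  if (j < n)%N then x
  else if (j < n + b)%N then
    ((if reverse then n + n + b - j.+1 else j)%N,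
     c (+) (slide != None), if slide is Some q then d (+) (c (+) q) else d)
  else ((j - b + a)%N, c, d).

Arguments relabel : simpl never.

(** Labels of the box stay within it, and later ones are shifted by [a - b], so the relabelling is
    injective. With [Some q] exactly one of the two branches turns, as [word_poly_relabel] requires
    when branches are exchanged. *)
Lemma word_poly_relabel_slices n a b reverse slide P :
  gauss_word P -> (b <= a)%N ->
  word_poly [seq relabel n a b reverse slide x | x <- P] = word_poly P.
Proof.
move=> gP ba.
pose f j := (if j < n then j
   else if j < n + b then if reverse then n + n + b - j.+1 else j else j - b + a)%N.
pose flip j := [&& n <= j, j < n + b & slide != None]%N.
pose turn j c := [&& n <= j, j < n + b & if slide is Some q then c (+) q else false]%N.
rewrite -(@word_poly_relabel P f flip turn) //.
- congr word_poly; apply: eq_map => -[[j c] d]; rewrite /relabel /f /flip /turn /=.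
  case: ltnP => //=; rewrite ?addbF // => _; case: ltnP => //=; rewrite ?addbF // => _.
  by case: (slide) => [q|]; rewrite ?addbF.
- move=> i j _ _; rewrite /f; case: (reverse); do !case: ifP; lia.
- by move=> j; rewrite /turn /flip; case: (n <= j)%N; case: (j < n + b)%N; case: (slide) => [[]|].
Qed.

(** * From matched boxes to equal word polynomials *)

Definition walks (D : seq (slice unit)) (P : seq letter) : Prop :=
  exists m z, zrun m ([::], D, 0%N, true) P z /\ exited z.

Lemma walks_match R pre A B post P P' : boxes_match (size pre) R A B ->
  R [::] [::] ->
  (forall j b d, (j < size pre)%N -> R [:: (j, b, d)] [:: (j, b, d)]) ->
  (forall j b d, R [:: (j + size A + size pre, b, d)%N]
                   [:: (j + size B + size pre, b, d)%N]) ->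
  walks (pre ++ A ++ post) P -> walks (pre ++ B ++ post) P' ->
  exists T : seq (seq letter * seq letter),
    [/\ P = flatten (unzip1 T), P' = flatten (unzip2 T)
      & {in T, forall p, R p.1 p.2}].
Proof.
move=> AB R0 R1 R2 [m [z [h ex]]] [m' [z' [h' ex']]].
apply: (outside_run AB R0 R1 R2 _ h h' ex ex').
exact: (@outside_left _ _ _ [::] pre post 0%N true).
Qed.

Lemma map_flatten_pairs (g : letter -> letter) (h : seq letter -> seq letter)
    (T : seq (seq letter * seq letter)) :
  {in T, forall p, h p.1 = map g p.2} ->
  flatten (map h (unzip1 T)) = map g (flatten (unzip2 T)).
Proof.
elim: T => //= p T IH hg; rewrite map_cat hg ?mem_head // IH // => q qT.
by apply: hg; rewrite in_cons qT orbT.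
Qed.

Section Invariance.
Variables (pre post A B : seq (slice unit)) (P P' : seq letter).
Variables (reverse : bool) (slide : option bool).
Hypotheses (walkP : walks (pre ++ A ++ post) P) (walkP' : walks (pre ++ B ++ post) P').
Hypotheses (gP : gauss_word P) (gP' : gauss_word P').
Hypothesis BA : (size B <= size A)%N.
Let n := size pre.
Notation g := (relabel n (size A) (size B) reverse slide).

Lemma relabel_before j c d : (j < n)%N -> g (j, c, d) = (j, c, d).
Proof. by move=> jn; rewrite /relabel jn. Qed.

Lemma relabel_after j c d :
  g ((j + size B + n)%N, c, d) = ((j + size A + n)%N, c, d).
Proof.
rewrite /relabel; case: ltnP => [|_]; first by lia.
by case: ltnP => [|_]; [lia|congr (_, _, _); lia].
Qed.

(** The case of moves whose matched trips differ only by relabelling; the three variants that follow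
    serve the flat moves Omega_1, Omega_2 and Omega_3. *)
Lemma word_poly_slices :
  boxes_match n (fun u v => u = map g v) A B -> word_poly P = word_poly P'.
Proof.
move=> AB; rewrite -(word_poly_relabel_slices n reverse slide gP' BA).
have [//|||T [-> -> RT]] := walks_match AB _ _ _ walkP walkP'.
- by move=> j b d jn; rewrite /= relabel_before.
- by move=> j b d; rewrite /= relabel_after.
by rewrite -(@map_flatten_pairs _ id) ?map_id.
Qed.

Lemma word_poly_slices1 c : (n <= c < n + size A)%N ->
  boxes_match n (fun u v => [seq x <- u | x.1.1 != c] = map g v /\
    (c \notin labels u \/ exists b d, u = [:: (c, b, d); (c, ~~ b, ~~ d)])) A B ->
  word_poly P = word_poly P'.
Proof.
move=> cn AB; rewrite -(word_poly_relabel_slices n reverse slide gP' BA).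
have [|||T [PT -> RT]] := walks_match AB _ _ _ walkP walkP'.
- by split=> //; left.
- move=> j b d jn; rewrite /= relabel_before //.
  rewrite (_ : j != c); last by lia.
  by split=> //; left; rewrite inE eq_sym; lia.
- move=> j b d; rewrite /= relabel_after.
  rewrite (_ : _ != c); last by lia.
  by split=> //; left; rewrite inE eq_sym; lia.
rewrite -(@map_flatten_pairs _ (filter (fun x => x.1.1 != c))); last by move=> p /RT[].
rewrite -filter_flatten -PT PT; apply: word_poly_omega1; first by rewrite -PT.
by move=> u /mapP[p pT ->]; case: (RT p pT).
Qed.

Lemma word_poly_slices2 : (2 <= size A)%N -> n \in labels P -> n.+1 \in labels P ->
  boxes_match n (fun u v => [seq x <- u | x.1.1 \notin [:: n; n.+1]] = map g v /\
    ((n \notin labels u /\ n.+1 \notin labels u) \/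
     exists st d, st \in omega2_strands n /\ u = trip st d)) A B ->
  word_poly P = word_poly P'.
Proof.
move=> A2 nP n1P AB; rewrite -(word_poly_relabel_slices n reverse slide gP' BA).
have [|||T [PT -> RT]] := walks_match AB _ _ _ walkP walkP'.
- by split=> //; left.
- move=> j b d jn; rewrite /= relabel_before // !inE ifT; last by lia.
  by split=> //; left; rewrite ?inE; split; lia.
- move=> j b d; rewrite /= relabel_after !inE ifT; last by lia.
  by split=> //; left; rewrite ?inE; split; lia.
rewrite -(@map_flatten_pairs _ (filter (fun x => x.1.1 \notin [:: n; n.+1]))); last first.
  by move=> p /RT[].
rewrite -filter_flatten -PT PT; apply: word_poly_omega2; rewrite -?PT //.
by move=> u /mapP[p pT ->]; case: (RT p pT).
Qed.

Lemma word_poly_slices3 : (3 <= size A)%N ->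
  n \in labels P -> n.+1 \in labels P -> n.+2 \in labels P ->
  boxes_match n (fun u v => rev u = map g v /\
    (u = [::] \/ (exists x, u = [:: x] /\ x.1.1 \notin [:: n; n.+1; n.+2]) \/
     exists st d, st \in omega3_strands n /\ u = trip st d)) A B ->
  word_poly P = word_poly P'.
Proof.
move=> A3 nP n1P n2P AB; rewrite -(word_poly_relabel_slices n reverse slide gP' BA).
have [|||T [PT -> RT]] := walks_match AB _ _ _ walkP walkP'.
- by split=> //; left.
- move=> j b d jn; rewrite /= relabel_before //; split=> //; right; left.
  by exists (j, b, d); split=> //; rewrite !inE /=; lia.
- move=> j b d; rewrite /= relabel_after; split=> //; right; left.
  by eexists; split; [reflexivity|rewrite !inE /=; lia].
rewrite -(@map_flatten_pairs _ rev); last by move=> p /RT[].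
rewrite PT; apply: (@word_poly_omega3 _ n); rewrite -?PT //.
by move=> u /mapP[p pT ->]; case: (RT p pT).
Qed.

End Invariance.

(** * The local moves as boxes *)

(** The box touches at most the strands [i], [i.+1] and [i.+2], so five positions and two directions
    of the walker cover all trips. *)
Ltac box_cases i :=
  let l := fresh "l" in let r := fresh "r" in let p := fresh "p" in
  let d := fresh "d" in
  move=> l r p d <-;
  have [?|[?|[?|[?|?]]]] : (p < i \/ p = i \/ p = i.+1 \/ p = i.+2 \/ i.+2 < p)%N;
  [lia|..]; try subst p; case: d; rewrite /entry ?/rev /=; box_go; try done.

Ltac relabel_go :=
  rewrite /= /relabel; decide_ifs; rewrite /=; repeat (f_equal; try lia).

Lemma boxes_zigzag_up n i :
  boxes_match n (fun u v => u = [seq relabel n 2 0 false None x | x <- v])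
    [:: (i, Birth); (i.+1, Death)] [::].
Proof. by box_cases i. Qed.

Lemma boxes_zigzag_down n i :
  boxes_match n (fun u v => u = [seq relabel n 2 0 false None x | x <- v])
    [:: (i.+1, Birth); (i, Death)] [::].
Proof.
box_cases i.
Qed.

(** In the first box the lower arm of the turn-back descends through the crossing, in the second the
    upper arm ascends, in the opposite direction of travel. Hence the flag [Some false]; at a death
    the second passage descends, hence [Some true]. *)
Lemma boxes_slide_birth n i v :
  boxes_match n (fun u v => u = [seq relabel n 2 2 false (Some false) x | x <- v])
    [:: (i.+1, Birth); (i, crossing v)] [:: (i, Birth); (i.+1, crossing v)].
Proof. case: v; box_cases i; relabel_go. Qed.

Lemma boxes_slide_death n i v :
  boxes_match n (fun u v => u = [seq relabel n 2 2 false (Some true) x | x <- v])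
    [:: (i, crossing v); (i.+1, Death)] [:: (i.+1, crossing v); (i, Death)].
Proof. case: v; box_cases i; relabel_go. Qed.

Lemma boxes_virtual1_birth n i :
  boxes_match n (fun u v => u = [seq relabel n 2 1 false None x | x <- v])
    [:: (i, Birth); (i, crossing true)] [:: (i, Birth)].
Proof. box_cases i. Qed.

Lemma boxes_virtual1_death n i :
  boxes_match n (fun u v => u = [seq relabel n 2 1 false None x | x <- v])
    [:: (i, crossing true); (i, Death)] [:: (i, Death)].
Proof. box_cases i. Qed.

Lemma boxes_virtual2 n i :
  boxes_match n (fun u v => u = [seq relabel n 2 0 false None x | x <- v])
    [:: (i, crossing true); (i, crossing true)] [::].
Proof. box_cases i. Qed.

Lemma boxes_virtual3 n i :
  boxes_match n (fun u v => u = [seq relabel n 3 3 false None x | x <- v])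
    [:: (i, crossing true); (i.+1, crossing true); (i, crossing true)]
    [:: (i.+1, crossing true); (i, crossing true); (i.+1, crossing true)].
Proof. box_cases i. Qed.

Lemma boxes_mixed3_top n i :
  boxes_match n (fun u v => u = [seq relabel n 3 3 true None x | x <- v])
    [:: (i, Cross tt); (i.+1, Virt); (i, Virt)]
               [:: (i.+1, Virt); (i, Virt); (i.+1, Cross tt)].
Proof. box_cases i; relabel_go. Qed.

Lemma boxes_mixed3_mid n i :
  boxes_match n (fun u v => u = [seq relabel n 3 3 true None x | x <- v])
    [:: (i, Virt); (i.+1, Cross tt); (i, Virt)]
               [:: (i.+1, Virt); (i, Cross tt); (i.+1, Virt)].
Proof. box_cases i; relabel_go. Qed.

Lemma boxes_mixed3_bot n i :
  boxes_match n (fun u v => u = [seq relabel n 3 3 true None x | x <- v])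
    [:: (i, Virt); (i.+1, Virt); (i, Cross tt)]
               [:: (i.+1, Cross tt); (i, Virt); (i.+1, Virt)].
Proof. box_cases i; relabel_go. Qed.

Lemma boxes_omega1_birth n i :
  boxes_match n (fun u v =>
    [seq x <- u | x.1.1 != n.+1] = [seq relabel n 2 1 false None x | x <- v] /\
    (n.+1 \notin labels u \/ exists b d, u = [:: (n.+1, b, d); (n.+1, ~~ b, ~~ d)]))
    [:: (i, Birth); (i, crossing false)] [:: (i, Birth)].
Proof.
box_cases i; (split; [by rewrite /= ?eqxx | rewrite /=; try by left]);
  right; first [by exists true, true | by exists true, false |
    by exists false, true | by exists false, false].
Qed.

Lemma boxes_omega1_death n i :
  boxes_match n (fun u v =>
    [seq x <- u | x.1.1 != n] = [seq relabel n 2 1 false None x | x <- v] /\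
    (n \notin labels u \/ exists b d, u = [:: (n, b, d); (n, ~~ b, ~~ d)]))
    [:: (i, crossing false); (i, Death)] [:: (i, Death)].
Proof.
box_cases i; (split; [by rewrite /= ?eqxx | rewrite /=; try by left]);
  right; first [by exists true, true | by exists true, false |
    by exists false, true | by exists false, false].
Qed.

Lemma boxes_omega2 n i :
  boxes_match n (fun u v =>
    [seq x <- u | x.1.1 \notin [:: n; n.+1]] = [seq relabel n 2 0 false None x | x <- v] /\
    ((n \notin labels u /\ n.+1 \notin labels u) \/
     exists st d, st \in omega2_strands n /\ u = trip st d))
    [:: (i, crossing false); (i, crossing false)] [::].
Proof.
box_cases i; (split; [by rewrite /= ?inE ?eqxx ?orbT | rewrite /=; try by left]); right;
  first [ by exists [:: (size l, true); ((size l).+1, false)], true; rewrite !inE eqxx ?orbT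
        | by exists [:: (size l, true); ((size l).+1, false)], false; rewrite !inE eqxx ?orbT
        | by exists [:: (size l, false); ((size l).+1, true)], true; rewrite !inE eqxx ?orbT
        | by exists [:: (size l, false); ((size l).+1, true)], false; rewrite !inE eqxx ?orbT].
Qed.

(** The two boxes list the crossings of the same pairs of strands in opposite orders, so each strand
    meets its two crossings in reversed order. *)
Lemma boxes_omega3 n i :
  boxes_match n (fun u v => rev u = [seq relabel n 3 3 true None x | x <- v] /\
    (u = [::] \/ (exists x, u = [:: x] /\ x.1.1 \notin [:: n; n.+1; n.+2]) \/
     exists st d, st \in omega3_strands n /\ u = trip st d))
    [:: (i, crossing false); (i.+1, crossing false); (i, crossing false)]
    [:: (i.+1, crossing false); (i, crossing false); (i.+1, crossing false)].
Proof.
box_cases i; (split; [by rewrite /rev /=; relabel_go | rewrite /=; try by left]); right; right;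
  first [ by exists [:: (size l, true); ((size l).+1, true)], true; rewrite !inE eqxx ?orbT
        | by exists [:: (size l, true); ((size l).+1, true)], false; rewrite !inE eqxx ?orbT
        | by exists [:: (size l, false); ((size l).+2, true)], true; rewrite !inE eqxx ?orbT
        | by exists [:: (size l, false); ((size l).+2, true)], false; rewrite !inE eqxx ?orbT
        | by exists [:: ((size l).+1, false); ((size l).+2, false)], true; rewrite !inE eqxx ?orbT
        | by exists [:: ((size l).+1, false); ((size l).+2, false)], false; rewrite !inE eqxx ?orbT].
Qed.


Lemma boxes_exchange n i j (g h : piece unit) : (i + right_ends g <= j)%N ->
  (* [e] below is the number of strands strictly between the two supports. *)
  boxes_match n (fun u v => u = [seq relabel n 2 2 true None x | x <- v])
    [:: (i, g); (j, h)] [:: ((j - right_ends g + left_ends g)%N, h); (i, g)].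
Proof.
move=> ij; have [e ->] : exists e, j = (i + right_ends g + e)%N.
  by exists (j - (i + right_ends g))%N; lia.
move=> l r p d <- {j ij n}.
(* [a] and [b] count the ends of [g] and [h] on the side where the walker enters. The seven cases
   are: below [g], its two ends, between, the two ends of [h], above. *)
pose a := if d then left_ends g else right_ends g.
pose b := if d then left_ends h else right_ends h.
have : a = 0%N \/ a = 2%N by rewrite /a; case: (d); case: (g); auto.
have : b = 0%N \/ b = 2%N by rewrite /b; case: (d); case: (h); auto.
move=> b02 a02; have {a02 b02} : (p < i \/ (p = i /\ 0 < a) \/ (p = i.+1 /\ 1 < a) \/ (i + a <= p < i + a + e) \/
  (p = i + a + e /\ 0 < b) \/ (p = (i + a + e).+1 /\ 1 < b) \/ i + a + e + b <= p)%N.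
  lia.
rewrite {}/a {}/b.
case: d; case: g => [||[]|]; case: h => [||[]|]; cbn [left_ends right_ends];
  (case=> [?|[[? ?]|[[? ?]|[?|[[? ?]|[[? ?]|?]]]]]]; first [lia | idtac]); try subst p;
  rewrite /entry ?/rev /=; box_go; first [done | relabel_go].
Qed.

(** * The walk of a long knot *)

Lemma onth_lt (T : Type) (s : seq T) j x : onth s j = Some x -> (j < size s)%N.
Proof. by rewrite -onthTE => ->. Qed.

Lemma pmap_in_uniq (T U : eqType) (f : T -> option U) (s : seq T) :
  uniq s ->
  {in s &, forall x y u, f x = Some u -> f y = Some u -> x = y} ->
  uniq (pmap f s).
Proof.
elim: s => //= x s IH /andP[xs us] fI.
have {}IH : uniq (pmap f s).
  by apply: IH => // y z ys zs; apply: fI; rewrite in_cons ?ys ?zs orbT.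
case fx: (f x) => [u|] //=; rewrite IH andbT mem_pmap.
apply/mapP => -[y ys fy]; move: xs; rewrite (fI x y _ _ u) ?ys //.
  exact: mem_head.
by rewrite in_cons ys orbT.
Qed.

Section Widths.
Variable C : Type.
Implicit Types (D : seq (slice C)).

Lemma size_widths n D : size (widths n D) = (size D).+1.
Proof. by elim: D n => //= -[i g] D IH n; rewrite IH. Qed.

Lemma widths_last n D m : typed n D m -> nth 0%N (widths n D) (size D) = m.
Proof. by elim: D n => [|[i g] D IH] n /=; [move/eqP|case/andP=> _ /IH]. Qed.

Lemma widths_slice n D m j i g : typed n D m -> onth D j = Some (i, g) ->
  (i + left_ends g <= nth 0 (widths n D) j)%N.
Proof.
elim: D n j => [|[i' g'] D IH] n [|j] //=; first by case/andP=> h _ [<- <-].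
by case/andP=> _ /IH h /h.
Qed.

End Widths.

Section LongKnot.
Variable D : seq (slice unit).
Hypothesis knotD : long_knot D.

Let N := sumn (widths 1 D).
Let st a := iter a (step D) (0%N, 0%N, true).
Let width k := nth 0%N (widths 1 D) k.
Let points := [seq (k, p) | k <- iota 0 (size D).+1, p <- iota 0 (width k)].

Let typedD : typed 1 D 1. Proof. by case/andP: knotD. Qed.

Lemma size_points : size points = N.
Proof.
rewrite size_allpairs_dep /N; congr sumn.
rewrite -[RHS](mkseq_nth 0%N) /mkseq size_widths.
by apply: eq_map => k; rewrite size_iota.
Qed.

Lemma uniq_points : uniq points.
Proof.
apply: allpairs_uniq_dep => [|k _|[k p] [k' p'] _ _ /= [-> ->] //]; exact: iota_uniq.
Qed.

Lemma mem_points k p : ((k, p) \in points) = (k <= size D)%N && (p < width k)%N.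
Proof.
apply/allpairsPdep/andP => [[k' [p' []]]|[kD pw]].
  by rewrite !mem_iota !add0n => ? ? [-> ->].
by exists k, p; rewrite !mem_iota !add0n.
Qed.

Lemma size_walk : size (walk D) = N. Proof. exact: size_traject. Qed.

Lemma points_walk : {subset points <= [seq s.1 | s <- walk D]}.
Proof.
move=> [k p]; rewrite mem_points => /andP[kD pw].
have /andP[_ /allP/(_ k)] := knotD.
by rewrite mem_iota add0n ltnS kD => /(_ isT)/allP/(_ p); rewrite mem_iota add0n pw; apply.
Qed.

(** Pigeonhole: the walk has as many states as there are points, and it meets all of them. *)
Lemma points_uniq_walk : uniq [seq s.1 | s <- walk D].
Proof.
apply: (leq_size_uniq uniq_points points_walk).
by rewrite size_map size_walk size_points.
Qed.

Lemma walk_points : [seq s.1 | s <- walk D] =i points.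
Proof.
have [|_ h] := uniq_min_size uniq_points points_walk.
  by rewrite size_map size_walk size_points.
by move=> x; rewrite h.
Qed.

Lemma nth_walk a : (a < N)%N -> nth (0%N, 0%N, true) (walk D) a = st a.
Proof. by move=> aN; rewrite nth_traject. Qed.

Lemma point_inj a b : (a < N)%N -> (b < N)%N -> (st a).1 = (st b).1 -> a = b.
Proof.
move=> aN bN; rewrite -!nth_walk // -!(nth_map _ (0%N, 0%N) fst) ?size_walk //.
by move/eqP; rewrite nth_uniq ?size_map ?size_walk ?points_uniq_walk // => /eqP.
Qed.

Lemma point_valid a : (a < N)%N ->
  ((st a).1.1 <= size D)%N /\ ((st a).1.2 < width (st a).1.1)%N.
Proof.
move=> aN; apply/andP; rewrite -mem_points -walk_points -surjective_pairing.
by apply: map_f; rewrite -nth_walk // mem_nth // size_walk.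
Qed.

Lemma point_visited k p : (k <= size D)%N -> (p < width k)%N ->
  exists2 a, (a < N)%N & (st a).1 = (k, p).
Proof.
move=> kD pw; have : (k, p) \in [seq s.1 | s <- walk D].
  by rewrite walk_points mem_points kD.
case/mapP=> s sw ->; exists (index s (walk D)).
  by rewrite -size_walk index_mem.
by rewrite -nth_walk ?nth_index // -size_walk index_mem.
Qed.

Lemma step_stuck s : onth D (next_slice s) = None -> step D s = s.
Proof. by case: s => [[k p] d] /= ->. Qed.

Lemma step_slice s sl : onth D (next_slice s) = Some sl ->
  step D s = (if (through sl s.1.2 s.2).2 then (next_slice s).+1 else next_slice s,
              (through sl s.1.2 s.2).1, (through sl s.1.2 s.2).2).
Proof. by case: s => [[k p] d] /= ->; case: (through sl p d). Qed.

Lemma walk_exit : exists m, [/\ N = m.+1, st m = (size D, 0%N, true)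
  & forall a, (a < m)%N -> (exists sl, onth D (next_slice (st a)) = Some sl) /\
      ((st a).2 = false -> (0 < (st a).1.1)%N)].
Proof.
have w1 : width (size D) = 1%N by apply: widths_last typedD.
have [m mN mE] : exists2 a, (a < N)%N & (st a).1 = (size D, 0%N).
  by apply: point_visited; rewrite ?w1.
have stm : st m = (size D, 0%N, true).
  rewrite [LHS]surjective_pairing mE; congr pair.
  (* Past the start, the point was reached by a step. A stuck step would repeat a point, and a
     leftward step ends below the last level. *)
  case: m mN mE => // m mN mE; have neq : (st m.+1).1 <> (st m).1.
    by move/(point_inj mN (ltnW mN)) => /eqP; rewrite eqn_leq ltnn.
  case E: (onth D (next_slice (st m))) => [sl|]; last first.
    by case: neq; rewrite {1}/st iterS step_stuck.
  move: mE; rewrite /st iterS (step_slice E) /=.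
  have jD := onth_lt E; case: ifP => //.
  by move=> _ [e _]; move: jD; rewrite e ltnn.
(* No slice lies beyond the last level, so a further state would repeat the point. *)
have NE : N = m.+1.
  apply/eqP; rewrite eqn_leq mN andbT leqNgt; apply/negP => lt.
  have /eqP : m.+1 = m.
    by apply: point_inj => //; rewrite /st iterS step_stuck //= -/(st m) stm /= onth_default.
  by rewrite eqn_leq ltnn.
exists m; split=> // a am; have aN : (a < N)%N by rewrite NE; lia.
split.
  case E: (onth D (next_slice (st a))) => [sl|]; first by exists sl.
  have /eqP : a.+1 = a.
    by apply: point_inj => //; [rewrite NE; lia|rewrite /st iterS step_stuck].
  by rewrite eqn_leq ltnn.
(* With truncated predecessor, a leftward state at level 0 would reenter slice 0. But the only point
   of level 0 is the start, which is left rightwards. *)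
move=> d0; rewrite lt0n; apply/eqP => k0.
have [_] := point_valid aN; rewrite k0 (_ : width 0 = 1%N); last first.
  by rewrite /width; case: (D) => [|[]].
rewrite ltnS leqn0 => /eqP p0.
have a0 : a = 0%N.
  by apply: point_inj => //; rewrite ?NE // [(st a).1]surjective_pairing k0 p0.
by move: d0; rewrite a0.
Qed.

Definition zip_state (s : state) : zipper :=
  let: (k, p, d) := s in (rev (take k D), drop k D, p, d).

Lemma zstep_step s : (exists sl, onth D (next_slice s) = Some sl) ->
  (s.2 = false -> (0 < s.1.1)%N) ->
  zstep (zip_state s) = Some (seq_of_opt (passage D s), zip_state (step D s)).
Proof.
case: s => [[k p] d] [sl E] k0; rewrite (step_slice E) /passage E.
case: sl E => i g E; have jD := onth_lt E; 
have nE : nth (i, g) D (next_slice (k, p, d)) = (i, g) by apply: onth_nth E.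
have split_at j x : (j < size D)%N -> nth x D j = x ->
    rev (take j.+1 D) = x :: rev (take j D) /\ drop j D = x :: drop j.+1 D.
  by move=> jlt nx; rewrite (take_nth x) // rev_rcons nx (drop_nth x) // nx.
case: d E jD nE k0 => /= [E jD nE _|E jD nE /(_ erefl)].
  have [tE dE] := split_at _ _ jD nE.
  rewrite dE; rewrite [through _ _ _]surjective_pairing.
  rewrite size_rev size_takel ?(ltnW jD) //; congr (Some (_, _)).
    by case: (g) => //= _; case: ifP.
  by case: ifP => _; rewrite ?tE ?dE.
case: k E jD nE => // k /= E jD nE _; have [tE dE] := split_at _ _ jD nE.
rewrite tE; rewrite [through _ _ _]surjective_pairing.
rewrite size_rev size_takel ?(ltnW jD) //; congr (Some (_, _)).
  by case: (g) => //= _; case: ifP.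
by case: ifP => _; rewrite ?tE ?dE.
Qed.

Lemma passages_exit m : N = m.+1 -> st m = (size D, 0%N, true) ->
  passages D = pmap (passage D) (traject (step D) (0%N, 0%N, true) m).
Proof.
move=> NE stm; rewrite /passages /walk -/N NE trajectSr -cats1 pmap_cat /= -/(st m) stm.
by rewrite /= onth_default ?cats0.
Qed.

Lemma long_knot_walks : walks D (passages D).
Proof.
have [m [NE stm moving]] := walk_exit; rewrite (passages_exit NE stm).
exists m, (zip_state (st m)); split; last by rewrite stm /= drop_size.
suff run n a : (a + n = m)%N ->
    zrun n (zip_state (st a)) (pmap (passage D) (traject (step D) (st a) n))
      (zip_state (st m)).
  by move: (run m 0%N erefl); rewrite /= take0 drop0.
elim: n a => [|n IH] a am; first by rewrite -am addn0; apply: zrun0.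
have [|sl k0] := moving a; first by lia.
have -> : pmap (passage D) (traject (step D) (st a) n.+1) =
    seq_of_opt (passage D (st a)) ++ pmap (passage D) (traject (step D) (st a.+1) n).
  by rewrite /=; case: (passage D (st a)).
apply: zrunS (zstep_step sl k0) _.
rewrite -[step D (st a)]/(st a.+1).
by apply: (IH a.+1); rewrite -am addnS.
Qed.

Lemma mem_passages x :
  (x \in passages D) <-> exists2 a, (a < N)%N & passage D (st a) = Some x.
Proof.
rewrite mem_pmap; split=> [/mapP[s sw xs]|[a aN xa]].
  have iN : (index s (walk D) < N)%N by rewrite -size_walk index_mem.
  by exists (index s (walk D)); rewrite // -nth_walk // nth_index.
by apply/mapP; exists (st a); rewrite // -nth_walk // mem_nth // size_walk.
Qed.

Lemma passageP s j c d : (exists sl, onth D (next_slice s) = Some sl) ->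
  (s.2 = false -> (0 < s.1.1)%N) -> passage D s = Some (j, c, d) ->
  exists i e p, [/\ onth D j = Some (i, Cross e), (i <= p <= i.+1)%N,
    c = ((p == i) == d) & s = (if d then j else j.+1, p, d)].
Proof.
case: s => [[k p] d'] [[i g] E] /= k0; rewrite E.
case: g E => // e E; case: ifP => // ip [jE <- <-]; exists i, e, p; split=> //.
  by rewrite -jE.
by move: jE k0; case: d' {E} => [->//|<- /(_ erefl)] /prednK ->.
Qed.

Lemma step_crossing j i e p d : onth D j = Some (i, Cross e) -> (i <= p <= i.+1)%N ->
  step D (if d then j else j.+1, p, d) = (if d then j.+1 else j, across i p, d).
Proof.
move=> E ip; have jE : next_slice (if d then j else j.+1, p, d) = j by case: d.
rewrite (@step_slice _ (i, Cross e)) ?jE //.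
have -> : through (i, Cross e) p d = (across i p, d).
  rewrite /through; case: ltnP => [|_]; first by lia.
  by case: leqP => // ; case: (d) => /=; lia.
by [].
Qed.

Lemma passages_gauss_word : gauss_word (passages D) /\
  forall j, (j \in labels (passages D)) <-> exists i e, onth D j = Some (i, Cross e).
Proof.
have [m [NE stm moving]] := walk_exit.
have passE a x : (a < N)%N -> passage D (st a) = Some x -> (a < m)%N.
  move=> aN; rewrite NE ltnS leq_eqVlt in aN; case/orP: aN => // /eqP ->.
  by rewrite stm /= onth_default.
have locate a j c d : (a < N)%N -> passage D (st a) = Some (j, c, d) ->
    exists i e p, [/\ onth D j = Some (i, Cross e), (i <= p <= i.+1)%N,
    c = ((p == i) == d) & st a = (if d then j else j.+1, p, d)].
  by move=> aN pa; have [sl a0] := moving a (passE _ _ aN pa); apply: passageP pa.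
have same a b j c d : (a < N)%N -> (b < N)%N -> passage D (st a) = Some (j, c, d) ->
    passage D (st b) = Some (j, c, d) -> a = b.
  move=> aN bN pa pb.
  have [i [e [p [E ip cE sa]]]] := locate _ _ _ _ aN pa.
  have [i' [e' [p' [E' ip' cE' sb]]]] := locate _ _ _ _ bN pb.
  move: E'; rewrite E => -[ii _]; subst i'.
  apply: point_inj => //; rewrite sa sb /=; congr (_, _).
  by move: cE; rewrite cE'; case: (d); case: (p =P i); case: (p' =P i) => //=; lia.
(* A rightward passage ends at the point where a leftward one along the same branch starts; that
   point would carry both directions. *)
have opposite a b j c : (a < N)%N -> (b < N)%N ->
    passage D (st a) = Some (j, c, true) -> passage D (st b) <> Some (j, c, false).
  move=> aN bN pa pb; have am := passE _ _ aN pa.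
  have [i [e [p [E ip cE sa]]]] := locate _ _ _ _ aN pa.
  have [i' [e' [p' [E' ip' cE' sb]]]] := locate _ _ _ _ bN pb.
  move: E'; rewrite E => -[ii _]; subst i'.
  have sa1 : st a.+1 = (j.+1, across i p, true).
    by rewrite /st iterS -/(st a) sa (@step_crossing j i e p true).
  have ab : a.+1 = b.
    apply: point_inj; rewrite ?NE; [lia|lia|].
    rewrite sb sa1 /=; congr (_, _); rewrite /across.
    by move: cE; rewrite cE'; case: (p =P i); case: (p' =P i) => //=; lia.
  by move: sb; rewrite -ab sa1.
have inj a b j c d d' : (a < N)%N -> (b < N)%N -> passage D (st a) = Some (j, c, d) ->
    passage D (st b) = Some (j, c, d') -> a = b.
  case: d d' => [] [] aN bN pa pb; try exact: same pa pb.
    by case: (opposite a b j c aN bN pa pb).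
  by case: (opposite b a j c bN aN pb pa).
(* The left end of the branch is visited. If rightward, the passage starts there; if leftward, it is
   the preceding state, which exists because the start is rightward. *)
have occurs j i e c : onth D j = Some (i, Cross e) -> (j, c) \in [seq x.1 | x <- passages D].
  move=> E; have jD := onth_lt E.
  have [||a aN aE] := @point_visited j (if c then i else i.+1); first by apply: ltnW.
    by have := widths_slice typedD E; rewrite /width /=; case: (c); lia.
  case sa : (st a) aE => [[k p] d] [? ?]; subst k p.
  have ip : (i <= (if c then i else i.+1) <= i.+1)%N by case: (c); lia.
  case: d sa => sa.
    apply/mapP; exists (j, c, true) => //; apply/mem_passages; exists a => //.
    by rewrite sa /= E ip; congr (Some (_, _, _)); case: (c); rewrite ?eqxx //; lia.
  case: a aN sa => // a aN sa.
  have [|[sl sE] _] := moving a; first by lia.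
  have := sa; rewrite /st iterS -/(st a) (step_slice sE) => -[jE pE dE].
  move: jE; rewrite dE => jE; move: sE; rewrite jE E => -[slE]; rewrite -slE in pE dE.
  apply/mapP; exists (j, c, (st a).2) => //; apply/mem_passages; exists a; first by lia.
  case: (st a) jE pE dE => [[k p] d] /= -> ; rewrite E.
  case: ltnP => [lt /= pE|ge]; first by move: lt; rewrite pE; case: (c); lia.
  case: leqP => [le|lt] /= pE dE.
    by move: le pE; case: (d); case: (c) => /=; lia.
  rewrite ifT; last by move: lt; case: (d); lia.
  rewrite dE; congr (Some (_, _, _)); move: pE; rewrite /across.
  by case: (c); case: eqP => //; lia.
have lab j : (j \in labels (passages D)) <-> exists i e, onth D j = Some (i, Cross e).
  split=> [/mapP[[[j' c] d] /mem_passages[a aN pa] /= ->]|[i [e E]]].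
    have [sl a0] := moving a (passE _ _ aN pa).
    by have [i [e [p [E _ _ _]]]] := passageP sl a0 pa; exists i, e.
  by have /mapP[x xP xE] := occurs j i e true E; apply/mapP; exists x; rewrite // -xE.
split=> //; split.
  rewrite map_inj_in_uniq.
    apply: pmap_in_uniq; first by have := points_uniq_walk; apply: map_uniq.
    move=> s s' sw s'w [[j c] d] pa pb.
    rewrite -(nth_index (0%N, 0%N, true) sw) -(nth_index (0%N, 0%N, true) s'w); congr nth.
    apply: (inj _ _ j c d d); rewrite -?size_walk ?index_mem // -nth_walk ?nth_index //;
    by rewrite -size_walk index_mem.
  move=> [[j c] d] [[j' c'] d'] /mem_passages[a aN pa] /mem_passages[b bN pb] /= [ej ec].
  rewrite -ej -ec in pb *; move: (pb).
  by rewrite -(inj a b j c d d' aN bN pa pb) pa => -[->].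
move=> j c; apply/idP/idP => [/mapP[x xP xE]|/lab[i [e E]]]; last exact: occurs E.
by apply/mapP; exists x; rewrite // -xE.
Qed.

End LongKnot.

(** * Gauss diagrams *)

Definition forget (D : seq (slice bool)) : seq (slice unit) :=
  [seq (s.1, flatten_piece s.2) | s <- D].

Lemma onth_forget D j :
  onth (forget D) j = omap (fun s => (s.1, flatten_piece s.2)) (onth D j).
Proof. exact: onth_map. Qed.

Lemma widths_forget n D : widths n (forget D) = widths n D.
Proof. by elim: D n => //= -[i g] D IH n /=; rewrite IH; case: g. Qed.

Lemma step_forget D s : step (forget D) s = step D s.
Proof.
case: s => [[k p] d]; rewrite /step onth_forget; case: (onth D _) => [[i g]|] //=.
by case: g.
Qed.

Lemma walk_forget D : walk (forget D) = walk D.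
Proof.
rewrite /walk widths_forget; move: (sumn _) (_, true) => n s.
by elim: n s => //= n IH s; rewrite step_forget IH.
Qed.

Lemma passages_forget D : passages (forget D) = passages D.
Proof.
rewrite /passages walk_forget; apply: eq_pmap => -[[k p] d].
rewrite /passage onth_forget; case: (onth D _) => [[i g]|] //=.
by case: g.
Qed.

Lemma typed_forget n D m : typed n (forget D) m = typed n D m.
Proof. by elim: D n => //= -[i g] D IH n /=; rewrite IH; case: g. Qed.

Lemma long_knot_forget D : long_knot (forget D) = long_knot D.
Proof. by rewrite /long_knot typed_forget walk_forget widths_forget size_map. Qed.

Lemma overlying_exists (K : long_flat_diagram) :
  exists Kt : long_virtual_diagram, overlies Kt K.
Proof.
pose lift (g : piece unit) : piece bool := match g with
  | Birth => Birth | Death => Death | Cross _ => Cross true | Virt => Virt end.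
pose D := [seq (s.1, lift s.2) | s <- slices K].
have fD : forget D = slices K.
  rewrite /forget -map_comp -[RHS]map_id; apply: eq_map => -[i [||[]|]] //.
have kD : long_knot D by rewrite -long_knot_forget fD; apply: slicesP.
by exists (Diagram kD).
Qed.

(** Without repetitions, the index of an entry is its position, so the test selects the middle
    block. *)
Lemma sum_between (T : eqType) (F : T -> int) (r s t : seq T) : uniq (r ++ s ++ t) ->
  \sum_(x <- r ++ s ++ t)
     F x *+ (size r <= index x (r ++ s ++ t) < size r + size s)%N =
  \sum_(x <- s) F x.
Proof.
rewrite !cat_uniq has_cat negb_or => /and5P[_ /andP[/hasPn rs /hasPn rt] _ /hasPn st _].
rewrite !big_cat /= big_seq big1 ?add0r => [|x xr]; last first.
  by rewrite index_cat xr leqNgt index_mem xr.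
rewrite [X in _ + X]big_seq [X in _ + X]big1 ?addr0 => [|x xt]; last first.
  rewrite !index_cat (negbTE (rt x xt)) (negbTE (st x xt)).
  by rewrite addnA [X in (_ && X)]ltnNge leq_addr andbF.
rewrite big_seq [RHS]big_seq; apply: eq_bigr => x xs.
rewrite !index_cat (negbTE (rs x xs)) xs leq_addr ltn_add2l index_mem xs.
by rewrite mulr1n.
Qed.

(** An arrow counts its sign at the tail and the opposite sign at the head; with both ends inside it
    cancels. *)
Lemma index_of_sum (G : seq arrow) (c : arrow) :
  all (fun a => (sign a == 1) || (sign a == -1)) G ->
  index_of G c = \sum_(a <- G)
    (sign a *+ inside c (tail a) - sign a *+ inside c (Defs.head a)).
Proof.
rewrite /index_of /ucount /dcount; elim: G => [|a G IH] /=; first by rewrite big_nil.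
case/andP=> sa /IH {}IH; rewrite big_cons -IH.
case/orP: sa => /eqP ->; case: (inside c (tail a)); case: (inside c (Defs.head a));
  rewrite /= ?mulr1n ?mulr0n; lia.
Qed.

Lemma split_crossing P a : gauss_word P -> a \in labels P ->
  exists u x v y w, [/\ P = u ++ x :: v ++ y :: w, x.1.1 = a & y.1 = (a, ~~ x.1.2)].
Proof.
move=> [uP cP] aP.
have /mapP[x xP xE] : (a, true) \in [seq x.1 | x <- P] by rewrite cP.
have /mapP[y yP yE] : (a, false) \in [seq x.1 | x <- P] by rewrite cP.
have xy : (y == x) = false by apply/eqP => xy; move: xE; rewrite -xy -yE.
case/splitPr: xP yP => p1 p2; rewrite mem_cat in_cons xy /= => /orP[] /splitPr[q1 q2].
  by exists q1, y, q2, x, p2; rewrite -xE -yE -catA.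
by exists p1, x, q1, y, q2; rewrite -xE -yE.
Qed.

(** * Arrows of the Gauss diagram in terms of the word of passages *)

Section Arrows.
Variable D : seq (slice bool).
Hypothesis knotD : long_knot D.
Let P := passages D.
Let k := same_way P.
Let X := [seq x.1 | x <- P].
Let eta (y : nat * bool) : int := k y.1 * (-1) ^+ y.2.

Definition crossings : seq (nat * bool) :=
  pmap (fun j => if onth D j is Some (_, Cross c) then Some (j, c) else None)
       (iota 0 (size D)).

Definition arrow_of (y : nat * bool) : arrow :=
  Arrow (time D y.1 y.2) (time D y.1 (~~ y.2)) (writhe D y.1 y.2).

Lemma gauss_diagramE : gauss_diagram D = [seq arrow_of y | y <- crossings].
Proof.
rewrite /gauss_diagram /crossings; elim: (iota _ _) => //= j s IH.
by case: (onth D j) => [[i [||c|]]|] //=; rewrite IH.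
Qed.

Lemma timeE j b : time D j b = index (j, b) X.
Proof. by rewrite /time /index /X find_map. Qed.

(** The over branch comes first in the frame, so the writhe is the value of the over passage. *)
Lemma writheE j c : writhe D j c = eta (j, c).
Proof.
rewrite /writhe /velocity /eta /k /same_way /=.
by case: c => /=; case: ((j, true, true) \in _); case: ((j, false, true) \in _).
Qed.

Let gP : gauss_word P.
Proof.
by rewrite /P -passages_forget; apply passages_gauss_word; rewrite long_knot_forget.
Qed.

Lemma mem_crossings j c :
  ((j, c) \in crossings) <-> exists i, onth D j = Some (i, Cross c).
Proof.
rewrite mem_pmap; split=> [/mapP[j' _]|[i E]].
  by case E: (onth D j') => [[i [||c'|]]|] //= [-> ->]; exists i; rewrite -E.
by apply/mapP; exists j; rewrite ?E // mem_iota; apply: onth_lt E.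
Qed.

Lemma uniq_crossings : uniq (unzip1 crossings).
Proof.
have -> : unzip1 crossings =
    [seq j <- iota 0 (size D) | if onth D j is Some (_, Cross _) then true else false].
  rewrite /crossings; elim: (iota _ _) => //= j s IH.
  by case: (onth D j) => [[i [||c|]]|] //=; rewrite IH.
by rewrite filter_uniq ?iota_uniq.
Qed.

Lemma labels_crossings : labels P =i unzip1 crossings.
Proof.
have kD : long_knot (forget D) by rewrite long_knot_forget.
have [_ lab] := passages_gauss_word kD.
move=> j; apply/idP/mapP.
  rewrite /P -passages_forget => /lab[i [e]]; rewrite onth_forget.
  case E: (onth D j) => [[i' [||c|]]|] //= _.
  by exists (j, c) => //; apply/mem_crossings; exists i'.
case=> -[j' c] /mem_crossings[i E] /= ->; rewrite /P -passages_forget.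
by apply/lab; exists i, tt; rewrite onth_forget E.
Qed.

Lemma perm_crossings : perm_eq (flatten [seq [:: y; (y.1, ~~ y.2)] | y <- crossings]) X.
Proof.
have [uX cX] := gP.
apply: uniq_perm => //.
  elim: crossings uniq_crossings => //= -[j c] s IH /andP[js us].
  rewrite !inE xpair_eqE eqxx negb_or IH // andbT.
  have nf b : (j, b) \notin flatten [seq [:: y; (y.1, ~~ y.2)] | y <- s].
    apply: contra js => /flattenP[_ /mapP[[j' c'] ys ->]]; rewrite !inE => yE.
    by apply/mapP; exists (j', c') => //; case/orP: yE => /eqP[-> _].
  by rewrite !nf; case: (c).
move=> [j b]; rewrite /X cX labels_crossings; apply/flattenP/mapP.
  case=> _ /mapP[[j' c'] ys ->]; rewrite !inE => yE.
  by exists (j', c') => //; case/orP: yE => /eqP[-> _].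
case=> -[j' c] ys /= ->; exists [:: (j', c); (j', ~~ c)]; first exact: map_f ys.
by rewrite !inE !xpair_eqE eqxx; case: b; case: (c).
Qed.

(** The sign at the tail is the value of the over passage, and minus the sign at the head is the
    value of the under passage. The sum over arrow ends is thus one over passages, free of
    over/under choices. *)
Lemma index_of_arrow y :
  index_of (gauss_diagram D) (arrow_of y) =
  \sum_(x <- X) eta x *+ inside (arrow_of y) (index x X).
Proof.
rewrite gauss_diagramE index_of_sum; last first.
  rewrite all_map; apply/allP => z _ /=; rewrite writheE /eta /k /same_way.
  by case: addb; case: z.2.
rewrite big_map -(perm_big _ perm_crossings) /=.
elim: crossings => [|z s IH]; first by rewrite !big_nil.
rewrite /= !big_cons IH addrA; congr (_ + _).
rewrite /= !writheE !timeE -surjective_pairing; congr (_ + _).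
rewrite -mulNrn; congr (_ *+ _); rewrite /eta /=.
by case: z.2; rewrite ?expr0 ?expr1 ?mulr1 ?mulrN1 ?opprK.
Qed.

Lemma arrow_contribution y : y \in crossings ->
  (if index_of (gauss_diagram D) (arrow_of y) != 0 then
    (orient (arrow_of y) * sign (arrow_of y))%:~R *
      tvar ^ index_of (gauss_diagram D) (arrow_of y) else 0) =
  contribution k y.1 P.
Proof.
move=> yD; have yP : y.1 \in labels P by rewrite labels_crossings map_f.
have [u [x [v [z [w [PE xy zE]]]]]] := split_crossing gP yP.
have zx : z.1.1 = x.1.1 by rewrite zE xy.
rewrite -xy (contribution_split gP PE zx) -/k /monomial.
have [uX _] := gP.
have XE : X = rcons [seq t.1 | t <- u] x.1 ++ [seq t.1 | t <- v] ++ [seq t.1 | t <- z :: w].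
  by rewrite /X PE !map_cat /= map_cat /= cat_rcons.
have ix : index x.1 X = size u.
  have xu : x.1 \notin [seq t.1 | t <- u].
    move: uX; rewrite -/X XE -cats1 -!catA /= cat_uniq => /and3P[_ /hasPn/(_ x.1)].
    by rewrite mem_head => /(_ isT).
  by rewrite XE cat_rcons index_cat (negbTE xu) /= eqxx addn0 size_map.
have iz : index z.1 X = (size u + size v).+1.
  have XE' : X = [seq t.1 | t <- u ++ x :: v] ++ z.1 :: [seq t.1 | t <- w].
    by rewrite /X PE !map_cat /= map_cat /= -catA.
  have zu : z.1 \notin [seq t.1 | t <- u ++ x :: v].
    move: uX; rewrite -/X XE' cat_uniq => /and3P[_ /hasPn/(_ z.1)].
    by rewrite mem_head => /(_ isT).
  by rewrite XE' index_cat (negbTE zu) /= eqxx addn0 size_map size_cat /= addnS.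
(* If the over passage comes first, o = 1 and w is its value. Otherwise o = -1 and w is the value of
   the second passage, the opposite of the first. *)
have ends : (minn (tail (arrow_of y)) (Defs.head (arrow_of y)) = size u) /\
    (maxn (tail (arrow_of y)) (Defs.head (arrow_of y)) = (size u + size v).+1) /\
    orient (arrow_of y) * sign (arrow_of y) = value k x.
  rewrite /orient /= writheE !timeE; have xE : x.1 = (y.1, x.1.2).
    by rewrite -xy -surjective_pairing.
  have [yx|yx] := eqVneq x.1.2 y.2.
    rewrite yx in xE zE; rewrite -xE -zE ix iz.
    split; first by lia.
    split; first by lia.
    by rewrite ifT; [rewrite mul1r /value xE|lia].
  have yx' : y.2 = ~~ x.1.2 by move: yx; case: y.2; case: x.1.2.
  rewrite yx' negbK -xE -zE ix iz.
  split; first by lia.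
  split; first by lia.
  rewrite ifF; last by lia.
  rewrite zE mulN1r /value /eta /= xy.
  by case: x.1.2; rewrite ?expr0 ?expr1 ?mulr1 ?mulrN1 ?opprK.
have [lo [hi ->]] := ends.
have -> : index_of (gauss_diagram D) (arrow_of y) = weight k v; last by [].
rewrite index_of_arrow.
transitivity (\sum_(x0 <- [seq t.1 | t <- v]) eta x0); last by rewrite big_map.
(* Appending [x] to the left part turns the strict lower bound [size u] into a weak one. *)
rewrite -(@sum_between _ eta (rcons [seq t.1 | t <- u] x.1) _ [seq t.1 | t <- z :: w]).
  rewrite -XE; apply: eq_bigr => x0 _; congr (_ *+ nat_of_bool _).
  by rewrite /inside lo hi size_rcons !size_map addSn.
by rewrite -XE.
Qed.

Lemma arrows_word_poly :
  \sum_(c <- gauss_diagram D | index_of (gauss_diagram D) c != 0)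
     (orient c * sign c)%:~R * tvar ^ index_of (gauss_diagram D) c = word_poly P.
Proof.
rewrite /word_poly (perm_big (unzip1 crossings)) /=; last first.
  apply: uniq_perm; rewrite ?undup_uniq ?uniq_crossings // => j.
  by rewrite mem_undup labels_crossings.
rewrite big_map big_mkcond {1}gauss_diagramE big_map.
by apply: eq_big_seq => y /arrow_contribution.
Qed.

End Arrows.

Lemma W_word_poly (K : long_flat_diagram) (Kt : long_virtual_diagram) :
  overlies Kt K -> W Kt = word_poly (passages K).
Proof.
rewrite /overlies /W => <-; rewrite passages_forget.
by apply: arrows_word_poly; apply: slicesP.
Qed.

(** * Invariance *)

(** Flat Omega_1, Omega_2 and Omega_3 delete or reverse blocks; every other move only relabels
    letters. *)
Lemma word_poly_local_move pre A B post P P' :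
  local_move A B ->
  walks (pre ++ A ++ post) P -> walks (pre ++ B ++ post) P' ->
  gauss_word P -> gauss_word P' ->
  (forall j i, onth A j = Some (i, Cross tt) -> (j + size pre)%N \in labels P) ->
  word_poly P = word_poly P'.
Proof.
move=> AB wP wP' gP gP' labP; have BA : (size B <= size A)%N by case: AB.
case: AB wP wP' BA labP.
- move=> i j g h ij wP wP' BA _.
  exact (word_poly_slices wP wP' gP' BA (@boxes_exchange _ _ _ _ _ ij)).
- move=> i wP wP' BA _; exact (word_poly_slices wP wP' gP' BA (@boxes_zigzag_up _ i)).
- move=> i wP wP' BA _; exact (word_poly_slices wP wP' gP' BA (@boxes_zigzag_down _ i)).
- move=> i v wP wP' BA _; exact (word_poly_slices wP wP' gP' BA (@boxes_slide_birth _ i v)).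
- move=> i v wP wP' BA _; exact (word_poly_slices wP wP' gP' BA (@boxes_slide_death _ i v)).
- move=> i [] wP wP' BA _.
    exact (word_poly_slices wP wP' gP' BA (@boxes_virtual1_birth _ i)).
  by apply: (word_poly_slices1 wP wP' gP gP' BA _ (@boxes_omega1_birth _ i)) => /=; lia.
- move=> i [] wP wP' BA _.
    exact (word_poly_slices wP wP' gP' BA (@boxes_virtual1_death _ i)).
  by apply: (word_poly_slices1 wP wP' gP gP' BA _ (@boxes_omega1_death _ i)) => /=; lia.
- move=> i [] wP wP' BA labP.
    exact (word_poly_slices wP wP' gP' BA (@boxes_virtual2 _ i)).
  apply: (word_poly_slices2 wP wP' gP gP' BA _ _ _ (@boxes_omega2 _ i)) => //.
    exact: (labP 0%N i).
  exact: (labP 1%N i).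
- move=> i [] wP wP' BA labP.
    exact (word_poly_slices wP wP' gP' BA (@boxes_virtual3 _ i)).
  apply: (word_poly_slices3 wP wP' gP gP' BA _ _ _ _ (@boxes_omega3 _ i)) => //.
  - exact: (labP 0%N i).
  - exact: (labP 1%N i.+1).
  - exact: (labP 2%N i).
- move=> i wP wP' BA _; exact (word_poly_slices wP wP' gP' BA (@boxes_mixed3_top _ i)).
- move=> i wP wP' BA _; exact (word_poly_slices wP wP' gP' BA (@boxes_mixed3_mid _ i)).
- move=> i wP wP' BA _; exact (word_poly_slices wP wP' gP' BA (@boxes_mixed3_bot _ i)).
Qed.

Lemma word_poly_flat_move (K K' : long_flat_diagram) : flat_move K K' ->
  word_poly (passages K) = word_poly (passages K').
Proof.
case=> pre [A [B [post [KE KE' AB]]]].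
have [gK lK] := passages_gauss_word (slicesP K).
have [gK' _] := passages_gauss_word (slicesP K').
apply: (@word_poly_local_move pre A B post) => //.
- by rewrite -KE; apply: long_knot_walks; apply: slicesP.
- by rewrite -KE'; apply: long_knot_walks; apply: slicesP.
move=> j i E; apply/lK; exists i, tt; rewrite KE onth_cat ltnNge leq_addl /= addnK.
by rewrite onth_cat (onth_lt E).
Qed.

Lemma word_poly_flat_equiv (K K' : long_flat_diagram) : flat_equiv K K' ->
  word_poly (passages K) = word_poly (passages K').
Proof.
by elim=> [? ?|//|? ? _ ->|? ? ? _ -> _ ->] //; apply: word_poly_flat_move.
Qed.

Theorem theorem4p1 :
  (* every K has an overlying diagram, so that W_K is defined *)
  (forall K : long_flat_diagram,
     exists Kt : long_virtual_diagram, overlies Kt K) /\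
  (* W_K does not depend on the choice of the overlying diagram *)
  (forall (K : long_flat_diagram) (Kt Kt' : long_virtual_diagram),
     overlies Kt K -> overlies Kt' K -> W Kt = W Kt') /\
  (* W_K is an invariant of long flat virtual knots *)
  (forall (K K' : long_flat_diagram) (Kt Kt' : long_virtual_diagram),
     flat_equiv K K' -> overlies Kt K -> overlies Kt' K' -> W Kt = W Kt').
Proof.
split; first exact: overlying_exists.
split=> [K Kt Kt' o o'|K K' Kt Kt' eKK o o'].
  by rewrite (W_word_poly o) (W_word_poly o').
by rewrite (W_word_poly o) (W_word_poly o') (word_poly_flat_equiv eKK).
Qed.
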